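(* Let $\sigma$ be a probability measure on $(0,1/2]$ and let $\beta_m,\beta_s\in(0,1]$. Let $S:=\{p\in\Omega_1 : \exists i\ge 2,\ p_i=0\}$. For any $K_{\sigma,\beta_m,\beta_s}$-invariant probability measure $\mu$ on $\Omega_1$, $$\mu[S]=1 \quad\text{if}\quad \int \frac1x\,d\sigma(x)<\infty,\qquad\text{and}\qquad \mu[S]=0\quad\text{if}\quad \int\frac1x\,d\sigma(x)=\infty .$$
   Context: For a nonnegative sequence $x=(x_i)_{i\ge1}$ write $|x|=\sum_i x_i$ and $|x|_2^2=\sum_i x_i^2$. Let $\bar\Omega_{\le}$ be the set of sequences $p=(p_i)_{i\ge1}$ with $p_1\ge p_2\ge\dots\ge0$ and $|p|\le1$ (including the zero sequence), and let $\Omega_1=\{p\in\bar\Omega_\le: |p|=1\}$. These spaces carry the topology induced from the product topology on $\mathbb R^{\mathbb N}$ and the corresponding Borel $\sigma$-field. For $i\ne j$, $M_{ij}p$ denotes the nonincreasing sequence obtained from $p$ by merging $p_i$ and $p_j$ into one part $p_i+p_j$. For $0<u<1$, $S_i^up$ denotes the nonincreasing sequence obtained from $p$ by splitting $p_i$ into the two parts $up_i$ and $(1-u)p_i$. Both operations preserve $|p|$. For a probability measure $\sigma$ on $(0,1/2]$ and $\beta_m,\beta_s\in(0,1]$, define the Markov kernel on $\bar\Omega_\le$ $$K_{\sigma,\beta_m,\beta_s}(p,\cdot)=2\beta_m\sum_{i<j}p_ip_j\,\delta_{M_{ij}p}(\cdot)+\beta_s\sum_i p_i^2\int\delta_{S_i^up}(\cdot)\,d\sigma(u)+\bigl(1-\beta_m|p|^2+(\beta_m-\beta_s)|p|_2^2\bigr)\delta_p(\cdot).$$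 It preserves $\Omega_1$, so it is also a Markov kernel on $\Omega_1$. A probability measure $\mu$ is $K$-invariant if $\mu K=\mu$, where $\mu K(\cdot)=\int K(p,\cdot)\,d\mu(p)$. *)

(* Defs.v *)
From HB Require Import structures.
From mathcomp Require Import all_boot all_order all_algebra.
From mathcomp Require Import all_classical all_reals all_analysis.
From mathcomp Require Import lra.
Set Implicit Arguments.
Unset Strict Implicit.
Unset Printing Implicit Defensive.
Import Order.TTheory GRing.Theory Num.Theory.
Import numFieldNormedType.Exports.
Local Open Scope classical_set_scope.
Local Open Scope ring_scope.

(* Sequences are indexed from 0: the k-th part (k >= 1) of the partition is
   [p k.-1]. *)
Definition seqs (R : realType) := {ptws nat -> R}.

HB.instance Definition _ (R : realType) :=
  Topological.copy (seqs R) {ptws nat -> R}.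
HB.instance Definition _ (R : realType) := Pointed.copy (seqs R) (nat -> R).

Definition borel (T : ptopologicalType) := g_sigma_algebraType (@open T).

Section partitions.
Variable R : realType.
Implicit Types (p q : seqs R) (u v : R) (i j k n : nat).

Definition mass p : \bar R := (\sum_(k <oo) (p k)%:E)%E.

Definition norm2sq p : \bar R := (\sum_(k <oo) (p k ^+ 2)%:E)%E.

Definition nneg_seq p := forall k, 0 <= p k.

Definition noninc_seq p := {homo p : m n / (m <= n)%N >-> n <= m}.

Definition Omega_bar : set (seqs R) :=
  [set p | nneg_seq p /\ noninc_seq p /\ (mass p <= 1)%E].

Definition Omega1 : set (seqs R) := [set p | Omega_bar p /\ mass p = 1%E].

(* [bump i] skips i: this deletes the i-th entry of p. *)
Definition removep i p : seqs R := fun k => p (bump i k).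

(* For nonincreasing q, the k-th entry is q k as long as v <= q k, then v, then
   q k.-1. *)
Definition insertp v q : seqs R := fun k =>
  if k is k'.+1 then Num.max (q k) (Num.min v (q k')) else Num.max v (q 0%N).

(* M_{ij} p, meaningful for i != j; the larger index is removed first so that
   the smaller one is not shifted. *)
Definition mergep i j p : seqs R :=
  insertp (p i + p j) (removep (minn i j) (removep (maxn i j) p)).

(* S_i^u p, meaningful for 0 < u < 1. *)
Definition splitp i u p : seqs R :=
  insertp (u * p i) (insertp ((1 - u) * p i) (removep i p)).

Lemma nneg_removep i p : nneg_seq p -> nneg_seq (removep i p).
Proof. by move=> p0 k; exact: p0. Qed.

Lemma noninc_removep i p : noninc_seq p -> noninc_seq (removep i p).
Proof. by move=> dp m n mn; apply: dp; rewrite leq_bump2. Qed.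

Lemma nneg_insertp v p : nneg_seq p -> nneg_seq (insertp v p).
Proof. by move=> p0 [|k] /=; rewrite le_max p0 ?orbT. Qed.

Lemma noninc_insertp v p : noninc_seq p -> noninc_seq (insertp v p).
Proof.
move=> dp; have step k : insertp v p k.+1 <= insertp v p k.
  case: k => [|k] /=.
    by rewrite ge_max !le_max ge_min lexx (dp 0%N 1%N)// orbT.
  have h1 := dp _ _ (leqnSn k); have h2 := dp _ _ (leqnSn k.+1).
  rewrite ge_max !le_max h2 /=.
  by rewrite (_ : Num.min v (p k.+1) <= p k.+1) // ge_min lexx orbT.
move=> m n /subnK <-; elim: (n - m)%N => [|d IH]; first by rewrite add0n.
by rewrite addSn; exact: le_trans (step _) IH.
Qed.

Lemma cvg_mass p (x : R) : [series p k]_k @ \oo --> x -> mass p = x%:E.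
Proof.
move=> h; apply: cvg_lim => //.
under eq_fun do rewrite sumEFin.
by apply: cvg_EFin h; exact: nearW.
Qed.

Lemma mass_cvg p (x : R) : nneg_seq p -> mass p = x%:E -> [series p k]_k @ \oo --> x.
Proof.
move=> p0 px.
have h : (fun n => (\sum_(0 <= k < n) (p k)%:E)%E) @ \oo --> x%:E.
  rewrite -px; apply: is_cvg_nneseries => n _ _.
  by rewrite lee_fin.
by move/fine_cvg : h; under eq_fun do rewrite sumEFin.
Qed.

Lemma mass_removep i p (x : R) : nneg_seq p -> mass p = x%:E ->
  mass (removep i p) = (x - p i)%:E.
Proof.
move=> p0 /(mass_cvg p0) px; apply: cvg_mass.
have E n : (i <= n)%N ->
    \sum_(0 <= k < n) removep i p k = \sum_(0 <= k < n.+1) p k - p i.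
  move=> /subnK <-; elim: (n - i)%N => [|d IH].
    rewrite add0n big_nat_recr//= addrK; apply: eq_big_nat => k /andP[_ ki].
    by rewrite /removep /bump leqNgt ki.
  rewrite addSn big_nat_recr//= IH [in RHS]big_nat_recr//= addrAC.
  by rewrite /removep /bump leq_addl add1n.
have : (fun n => \sum_(0 <= k < n.+1) p k - p i) @ \oo --> x - p i.
  apply: cvgB; last exact: cvg_cst.
  by move: px; rewrite -(cvg_shiftS (series p)).
apply: cvg_trans; apply: near_eq_cvg; near=> n.
by rewrite /series/= E //; near: n; exact: nbhs_infty_ge.
Unshelve. all: by end_near. Qed.

Lemma mass_insertp v p (x : R) : 0 <= v -> nneg_seq p -> noninc_seq p ->
  mass p = x%:E -> mass (insertp v p) = (v + x)%:E.
Proof.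
move=> v0 p0 dp /(mass_cvg p0) px; apply: cvg_mass.
have E n : \sum_(0 <= k < n.+1) insertp v p k =
    v + \sum_(0 <= k < n.+1) p k - Num.min v (p n).
  elim: n => [|n IH].
    by rewrite !big_nat1 /=; case: (leP v (p 0%N)) => ?; lra.
  rewrite big_nat_recr//= IH [in RHS]big_nat_recr//=.
  have := dp _ _ (leqnSn n).
  case: (leP v (p n)) => ?; case: (leP v (p n.+1)) => ? /=;
  case: leP => ? ?; lra.
rewrite -cvg_shiftS.
rewrite (_ : (fun n => _) = (fun n =>
  v + \sum_(0 <= k < n.+1) p k - Num.min v (p n))); last first.
  by apply/funext => n; rewrite /series/= E.
rewrite -[v + x]subr0; apply: cvgB.
  apply: cvgD; first exact: cvg_cst.
  by move: px; rewrite -(cvg_shiftS (series p)).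
have p_0 : p n @[n --> \oo] --> (0 : R).
  apply: (@cvg_series_cvg_0 R R); apply/cvg_ex; exists x; exact: px.
apply: (squeeze_cvgr _ (cvg_cst 0) p_0).
by near=> n; rewrite le_min v0 p0 ge_min lexx orbT.
Unshelve. all: by end_near. Qed.

Lemma Omega_bar_massE p : Omega_bar p -> exists x : R, mass p = x%:E.
Proof.
move=> [p0 [_ m1]]; exists (fine (mass p)); rewrite fineK// ge0_fin_numE.
  exact: le_lt_trans m1 (ltry _).
by apply: nneseries_ge0 => n _ _; rewrite lee_fin.
Qed.

Lemma mass_mergep i j p : i != j -> Omega_bar p -> mass (mergep i j p) = mass p.
Proof.
move=> ij Op; have [x px] := Omega_bar_massE Op; case: Op => p0 [dp _].
have E : p (minn i j) + p (maxn i j) = p i + p j.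
  by case: (leqP i j) => _ //; rewrite addrC.
have mM : (minn i j < maxn i j)%N.
  by case: (leqP i j) => h; [rewrite ltn_neqAle ij | exact: h].
rewrite /mergep px (@mass_insertp _ _ (x - (p i + p j))) ?addr_ge0 //.
- by congr EFin; lra.
- by do 2 apply: nneg_removep.
- by do 2 apply: noninc_removep.
rewrite (mass_removep _ _ (mass_removep _ p0 px)); last exact: nneg_removep.
by congr EFin; rewrite -E /removep /bump leqNgt mM add0n; lra.
Qed.

Lemma mass_splitp i u p : 0 < u < 1 -> Omega_bar p ->
  mass (splitp i u p) = mass p.
Proof.
move=> /andP[u0 u1] Op; have [x px] := Omega_bar_massE Op; case: Op => p0 [dp _].
have p0' := nneg_removep i p0; have dp' := noninc_removep i dp.
have a0 : 0 <= u * p i by rewrite mulr_ge0// ltW.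
have b0 : 0 <= (1 - u) * p i by rewrite mulr_ge0// subr_ge0 ltW.
rewrite px (mass_insertp a0 _ _ (mass_insertp b0 p0' dp' (mass_removep i p0 px))).
- by congr EFin; lra.
- exact: nneg_insertp.
- exact: noninc_insertp.
Qed.

Lemma mergep_Omega_bar i j p : i != j -> Omega_bar p -> Omega_bar (mergep i j p).
Proof.
move=> ij Op; have [p0 [dp m1]] := Op; split; last split.
- by apply: nneg_insertp; do 2 apply: nneg_removep.
- by apply: noninc_insertp; do 2 apply: noninc_removep.
- by rewrite mass_mergep.
Qed.

Lemma splitp_Omega_bar i u p : 0 < u < 1 -> Omega_bar p ->
  Omega_bar (splitp i u p).
Proof.
move=> u01 Op; have [p0 [dp m1]] := Op; split; last split.
- by do 2 apply: nneg_insertp; apply: nneg_removep.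
- by do 2 apply: noninc_insertp; apply: noninc_removep.
- by rewrite mass_splitp.
Qed.

Lemma mergep_Omega1 i j p : i != j -> Omega1 p -> Omega1 (mergep i j p).
Proof.
by move=> ij [Op p1]; split; [exact: mergep_Omega_bar | rewrite mass_mergep].
Qed.

Lemma splitp_Omega1 i u p : 0 < u < 1 -> Omega1 p -> Omega1 (splitp i u p).
Proof.
by move=> u01 [Op p1]; split; [exact: splitp_Omega_bar | rewrite mass_splitp].
Qed.

Definition half_interval : set R := `]0, 2^-1]%classic.

Definition dirac_seqs p (A : set (seqs R)) : \bar R :=
  @dirac _ (borel (seqs R)) p R A.

Definition K (sigma : probability R R) (bm bs : R) p (A : set (seqs R)) :
    \bar R :=
  ((2 * bm)%:E *
     (\sum_(j <oo) \sum_(i < j) (p i * p j)%:E * dirac_seqs (mergep i j p) A)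
   + bs%:E *
     (\sum_(i <oo) (p i ^+ 2)%:E *
        \int[sigma]_(u in half_interval) dirac_seqs (splitp i u p) A)
   + (1 - bm%:E * mass p ^+ 2 + (bm - bs)%:E * norm2sq p) * dirac_seqs p A)%E.

Definition unit_part : seqs R := fun k => (k == 0%N)%:R.

Lemma Omega1_unit : Omega1 unit_part.
Proof.
have m1 : mass unit_part = 1%:E.
  apply: cvg_mass; rewrite -cvg_shiftS.
  rewrite (_ : (fun n => _) = (fun=> 1 : R)).
    by move=> ?; exact: (@cvg_cst R).
  by apply/funext => n; rewrite /series/= big_nat_recl//= big1 ?addr0.
split=> //; split; last split; last by rewrite m1.
- by move=> k; rewrite ler0n.
- by move=> [|m] [|n] //= _; rewrite ler_nat.
Qed.

End partitions.

Arguments Omega_bar R : clear implicits.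
Arguments Omega1 R : clear implicits.
Arguments half_interval R : clear implicits.

(* A copy of [set_type (Omega1 R)], which carries the induced topology, made
   pointed so that it can carry a measurable structure. *)
Definition Omega1_type (R : realType) : Type := set_type (Omega1 R).

HB.instance Definition _ (R : realType) :=
  Topological.copy (Omega1_type R) (set_type (Omega1 R)).
HB.instance Definition _ (R : realType) :=
  isPointed.Build (Omega1_type R)
    (exist (fun p => p \in Omega1 R) (unit_part R) (mem_set (Omega1_unit R))).

Definition val1 (R : realType) (p : Omega1_type R) : seqs R := \val p.

(* mu K = mu; a subset A of Omega1 is viewed inside the space of sequences. *)
Definition K_invariant (R : realType) (sigma : probability R R) (bm bs : R)
    (mu : probability (borel (Omega1_type R)) R) :=
  forall A : set (borel (Omega1_type R)), measurable A ->
    (\int[mu]_p K sigma bm bs (val1 p) (@val1 R @` A))%E = mu A.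

Definition finitely_many_parts (R : realType) : set (borel (Omega1_type R)) :=
  [set p | exists i : nat, (1 <= i)%N /\ val1 p i = 0].

Arguments finitely_many_parts R : clear implicits.

(* Main.v *)
Require Import Defs.
From mathcomp Require Import all_boot all_order all_algebra.
From mathcomp Require Import all_classical all_reals all_analysis.
From mathcomp Require Import measurable_realfun finmap.
From mathcomp Require Import zify ring lra.
Import Order.TTheory GRing.Theory Num.Theory.
Import numFieldNormedType.Exports.
Local Open Scope classical_set_scope.
Local Open Scope ring_scope.

Set Implicit Arguments.
Unset Strict Implicit.
Unset Printing Implicit Defensive.

(** Both claims are drift estimates.  Write [Kf] for the kernel applied to a
    function f.  If f is bounded and Kf + c 1_A <= f + D pointwise, then
    integrating against an invariant mu gives c mu(A) <= D; so a bounded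
    potential f with a large drift c on A and a bounded cost D forces A to be
    small.

    Let u have law sigma, with finite inverse moment C = E[1/u]. Take f(p) =
    sum_k phi(p_k) where phi(x) = x / (x^2 + eps^2) is a bounded version of
    1/x. As phi(x) / x decreases, phi is subadditive, so merging never
    increases f. A part x is split with probability bs x^2 and this adds at
    most 1/(u x) + 2/x to f, hence sum_i bs p_i^2 E[1/(u p_i) + 2/p_i] <= bs (C
    + 2) bounds the gain, uniformly in eps. Merging p_0, the largest part, with
    p_j >= eps lowers f by at least a constant over p_j, and this has
    probability 2 bm p_0 p_j: each such j contributes a constant multiple of
    p_0. Therefore mu(p_0 >= d, p_n >= eps) is at most a constant over d n.
    Letting eps tend to 0, then n to infinity, then d to 0, almost every
    partition has finitely many parts.

    Suppose that the inverse moment is infinite.  On partitions with finitely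
    many parts, take f = 1/eps - 1/(m + eps) where m is the smallest part, and
    f = 1/eps, its maximum, elsewhere.  Only a merge involving the smallest
    part can raise f; it has probability at most 2 bm m and raises f by at most
    1/m, so the cost is at most 2 bm whatever eps is.  Splitting the largest
    part produces a part of size at most u, so f drops at rate at least
    bs d^2 (E[1/(u + eps)] - 1/d) when all parts are at least d, and this is
    unbounded as eps tends to 0.  Hence for each d the partitions whose nonzero
    parts are finite in number and at least d are negligible.

    The integral of a nonnegative function is a supremum over simple functions
    below it, so it is monotone and superadditive even on functions that are
    not known to be measurable, such as p |-> K(p, A).  This gives
    int f dmu <= int Kf dmu ([K_invariant_le]), the direction that the drift
    argument uses ([drift_inequality]).  The two drift estimates are
    [first_and_last_bound] and [all_parts_ge_bound], both obtained from
    [Kfun_drift]. *)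

(* The algebraic hierarchy also exports a constant of this name. *)
Local Notation val1 := Defs.val1.

(** * Integrals of nonmeasurable nonnegative functions *)

Lemma ereal_sup_add_le (R : realType) (A B : set (\bar R)) (c : \bar R) :
  (forall a, A a -> 0 <= a)%E -> (forall b, B b -> 0 <= b)%E ->
  A !=set0 -> B !=set0 ->
  (forall a b, A a -> B b -> a + b <= c)%E ->
  (ereal_sup A + ereal_sup B <= c)%E.
Proof.
move=> A0 B0 [a1 Aa1] [b1 Bb1] ABc.
have supB0 : (0 <= ereal_sup B)%E.
  by apply: le_trans (B0 _ Bb1) _; exact: ereal_sup_ubound.
have step a : A a -> (a + ereal_sup B <= c)%E.
  move=> Aa; have [afin|] := boolP (a \is a fin_num).
    rewrite -leeBrDl//; apply: ge_ereal_sup => b Bb; rewrite leeBrDl//; exact: ABc.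
  rewrite ge0_fin_numE ?A0// -leNgt leye_eq => /eqP aoo.
  have := ABc _ _ Aa Bb1; rewrite aoo addye ?leye_eq; last first.
    by rewrite gt_eqF// (lt_le_trans _ (B0 _ Bb1)).
  by move=> /eqP ->; rewrite leey.
have [Bfin|] := boolP (ereal_sup B \is a fin_num).
  rewrite -leeBrDr//; apply: ge_ereal_sup => a Aa; rewrite leeBrDr//; exact: step.
rewrite ge0_fin_numE// -leNgt leye_eq => /eqP Boo.
have := step _ Aa1; rewrite Boo addey ?leye_eq; last first.
  by rewrite gt_eqF// (lt_le_trans _ (A0 _ Aa1)).
by move=> /eqP ->; rewrite leey.
Qed.

Section lower_integral.
Local Open Scope ereal_scope.
Context d (T : measurableType d) (R : realType).
Variable mu : {measure set T -> \bar R}.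
Implicit Types (D : set T) (f g : T -> \bar R).

Import HBNNSimple.

(** This and the next two lemmas hold without measurability because the
    integral is a lower integral: a simple function below f is below any g
    above f, and simple functions below f and g add up to one below their
    sum. *)
Lemma le_lower_integral D f g : (forall x, D x -> 0 <= f x) ->
  (forall x, D x -> f x <= g x) ->
  \int[mu]_(x in D) f x <= \int[mu]_(x in D) g x.
Proof.
move=> f0 fg; have g0 x : D x -> 0 <= g x by move=> Dx; rewrite (le_trans (f0 _ Dx))// fg.
rewrite !ge0_integralE//; apply: ereal_sup_le => _ [h hf <-]; exists h => // x.
by apply: (le_trans (hf x)); rewrite !patchE; case: ifPn => // /set_mem; exact: fg.
Qed.

Lemma lower_integralD D f g :
  (forall x, D x -> 0 <= f x) -> (forall x, D x -> 0 <= g x) ->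
  \int[mu]_(x in D) f x + \int[mu]_(x in D) g x <=
  \int[mu]_(x in D) (f x + g x).
Proof.
move=> f0 g0.
have h0 x : D x -> 0 <= f x + g x by move=> Dx; rewrite adde_ge0 ?f0 ?g0.
rewrite (ge0_integralE mu f0) (ge0_integralE mu g0).
have sint0 (u : T -> \bar R) : (forall x, D x -> 0 <= u x) ->
    [set sintegral mu h | h in [set h : {nnsfun T >-> R} |
      forall x, (h x)%:E <= (u \_ D) x]] !=set0.
  move=> u0; exists (sintegral mu (nnsfun0 : {nnsfun T >-> R})), nnsfun0 => // x /=.
  by rewrite patchE; case: ifPn => // /set_mem; exact: u0.
apply: ereal_sup_add_le; [| |exact: sint0|exact: sint0|].
- by move=> _ [h _ <-]; exact: sintegral_ge0.
- by move=> _ [h _ <-]; exact: sintegral_ge0.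
move=> _ _ [h /= hf <-] [k /= kg <-].
rewrite (ge0_integralE mu h0) -sintegralD; apply: ereal_sup_ubound.
exists (add_nnsfun h k) => // x /=.
move: (hf x) (kg x); rewrite !patchE; case: ifPn => [|] _ h1 k1.
  by rewrite EFinD leeD.
by rewrite EFinD -[leRHS]addr0 leeD.
Qed.

Lemma lower_integralZl D (r : R) f : (0 <= r)%R ->
  (forall x, D x -> 0 <= f x) ->
  r%:E * \int[mu]_(x in D) f x <= \int[mu]_(x in D) (r%:E * f x).
Proof.
move=> r0 f0; have h0 x : D x -> 0 <= r%:E * f x.
  by move=> Dx; rewrite mule_ge0 ?lee_fin ?f0.
have [->|rn0] := eqVneq r 0%R;
  first by rewrite mul0e integral_ge0// => x /f0 ?; rewrite mul0e.
have rp : (0 < r)%R by rewrite lt_neqAle eq_sym rn0.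
rewrite (ge0_integralE mu f0) (ge0_integralE mu h0) -ereal_sup_pZl//.
apply: ge_ereal_sup => _ [_ [h /= hf <-] <-]; rewrite -sintegralrM.
apply: ereal_sup_ubound.
exists (mul_nnsfun (cst_nnsfun T (NngNum r0)) h) => // x /=.
move: (hf x); rewrite !patchE; case: ifPn => [|] _ h1.
  by rewrite EFinM lee_wpmul2l// lee_fin.
by rewrite EFinM mule_ge0_le0// lee_fin.
Qed.

End lower_integral.

(** * The kernel acting on functions *)

Section kernel_on_functions.
Local Open Scope ereal_scope.
Context (R : realType) (sigma : probability R R) (bm bs : R).
Implicit Types (p q : seqs R) (f g : seqs R -> \bar R).

Definition merge_sum f p : \bar R :=
  \sum_(j <oo) \sum_(i < j) (p i * p j)%:E * f (mergep i j p).

Definition split_sum f p : \bar R :=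
  \sum_(i <oo) (p i ^+ 2)%:E *
    \int[sigma]_(u in half_interval R) f (splitp i u p).

Definition Kfun f p : \bar R :=
  (2 * bm)%:E * merge_sum f p + bs%:E * split_sum f p
  + (1 - bm%:E * mass p ^+ 2 + (bm - bs)%:E * norm2sq p) * f p.

Section at_p.
Variable p : seqs R.
Hypothesis p0 : nneg_seq p.

Lemma merge_term_ge0 f j : (forall q, 0 <= f q) ->
  0 <= \sum_(i < j) (p i * p j)%:E * f (mergep i j p).
Proof. by move=> f0; apply: sume_ge0 => i _; rewrite mule_ge0// lee_fin mulr_ge0. Qed.

Lemma split_term_ge0 f i : (forall q, 0 <= f q) ->
  0 <= (p i ^+ 2)%:E * \int[sigma]_(u in half_interval R) f (splitp i u p).
Proof.
by move=> f0; rewrite mule_ge0 ?lee_fin ?sqr_ge0//; exact: integral_ge0.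
Qed.

Lemma merge_sum_ge0 f : (forall q, 0 <= f q) -> 0 <= merge_sum f p.
Proof. by move=> f0; apply: nneseries_ge0 => *; exact: merge_term_ge0. Qed.

Lemma split_sum_ge0 f : (forall q, 0 <= f q) -> 0 <= split_sum f p.
Proof. by move=> f0; apply: nneseries_ge0 => *; exact: split_term_ge0. Qed.

Lemma le_merge_sum f g : (forall q, 0 <= f q) -> (forall q, f q <= g q) ->
  merge_sum f p <= merge_sum g p.
Proof.
move=> f0 fg; apply: lee_nneseries => [j _ _|j _]; first exact: merge_term_ge0.
by apply: lee_sum => i _; rewrite lee_wpmul2l// lee_fin mulr_ge0.
Qed.

Lemma le_split_sum f g : (forall q, 0 <= f q) -> (forall q, f q <= g q) ->
  split_sum f p <= split_sum g p.
Proof.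
move=> f0 fg; apply: lee_nneseries => [j _ _|j _]; first exact: split_term_ge0.
by rewrite lee_wpmul2l ?lee_fin ?sqr_ge0//; exact: le_lower_integral.
Qed.

Lemma merge_sum_superlinear r f g : (0 <= r)%R ->
  (forall q, 0 <= f q) -> (forall q, 0 <= g q) ->
  r%:E * merge_sum f p + merge_sum g p <= merge_sum (fun q => r%:E * f q + g q) p.
Proof.
move=> r0 f0 g0; rewrite -nneseriesZl; last by move=> *; exact: merge_term_ge0.
rewrite -nneseriesD; last 2 first.
- by move=> *; apply: mule_ge0; [rewrite lee_fin|exact: merge_term_ge0].
- by move=> *; exact: merge_term_ge0.
apply: lee_nneseries => [j _ _|j _].
  by apply: adde_ge0; [apply: mule_ge0; first by rewrite lee_fin|]; exact: merge_term_ge0.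
rewrite ge0_sume_distrr; last by move=> i _; rewrite mule_ge0 ?lee_fin ?mulr_ge0.
rewrite -big_split/=; apply: lee_sum => i _.
by rewrite ge0_muleDr ?mule_ge0 ?lee_fin// muleCA.
Qed.

Lemma split_sum_superlinear r f g : (0 <= r)%R ->
  (forall q, 0 <= f q) -> (forall q, 0 <= g q) ->
  r%:E * split_sum f p + split_sum g p <= split_sum (fun q => r%:E * f q + g q) p.
Proof.
move=> r0 f0 g0; rewrite -nneseriesZl; last by move=> *; exact: split_term_ge0.
rewrite -nneseriesD; last 2 first.
- by move=> *; apply: mule_ge0; [rewrite lee_fin|exact: split_term_ge0].
- by move=> *; exact: split_term_ge0.
apply: lee_nneseries => [j _ _|j _].
  by apply: adde_ge0; [apply: mule_ge0; first by rewrite lee_fin|]; exact: split_term_ge0.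
rewrite muleCA -ge0_muleDr; [|by rewrite mule_ge0 ?lee_fin// integral_ge0
                            |exact: integral_ge0].
rewrite lee_wpmul2l ?lee_fin ?sqr_ge0//.
apply: le_trans.
  by apply: leeD2r; apply: lower_integralZl.
by apply: lower_integralD => // x _; rewrite mule_ge0 ?lee_fin.
Qed.

End at_p.

Lemma Omega1_facts p : Omega1 R p ->
  [/\ nneg_seq p, noninc_seq p, mass p = 1 & forall i, (p i <= 1)%R].
Proof.
move=> [[p0 [dp _]] p1]; split=> // i.
rewrite -lee_fin -p1 /mass.
apply: le_trans (nneseries_lim_ge i.+1 _); last by move=> *; rewrite lee_fin.
by rewrite big_nat_recr//= leeDr// sume_ge0// => k _; rewrite lee_fin.
Qed.

Lemma norm2sq_Omega1 p : Omega1 R p -> exists2 s : R, norm2sq p = s%:E & (0 <= s <= 1)%R.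
Proof.
move=> /Omega1_facts[p0 dp p1 pl1].
have n0 : 0 <= norm2sq p by apply: nneseries_ge0 => *; rewrite lee_fin sqr_ge0.
have n1 : norm2sq p <= 1.
  rewrite -p1; apply: lee_nneseries => [*|k _]; first by rewrite lee_fin sqr_ge0.
  by rewrite lee_fin expr2 -[leRHS]mulr1 ler_wpM2l.
have nfin : norm2sq p \is a fin_num by rewrite ge0_fin_numE// (le_lt_trans n1)// ltry.
by exists (fine (norm2sq p)); rewrite ?fineK// -!lee_fin fineK// n0.
Qed.

Hypothesis hbm : (0 < bm <= 1)%R.
Hypothesis hbs : (0 < bs <= 1)%R.

Lemma stay_coefE p s : Omega1 R p -> norm2sq p = s%:E ->
  1 - bm%:E * mass p ^+ 2 + (bm - bs)%:E * norm2sq p = (1 - bm + (bm - bs) * s)%:E.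
Proof. by move=> /Omega1_facts[_ _ -> _] ->; rewrite expe2 mul1e mule1. Qed.

(** The coefficient is a combination of 1 - bm and 1 - bs with weights
    1 - |p|_2^2 and |p|_2^2. *)
Lemma stay_coef_ge0 p : Omega1 R p ->
  0 <= 1 - bm%:E * mass p ^+ 2 + (bm - bs)%:E * norm2sq p.
Proof.
move=> Op; have [s sE /andP[s0 s1]] := norm2sq_Omega1 Op.
rewrite (stay_coefE Op sE) lee_fin.
have [/andP[_ bm1] /andP[_ bs1]] := (hbm, hbs).
have -> : (1 - bm + (bm - bs) * s = (1 - bm) * (1 - s) + (1 - bs) * s)%R by ring.
by rewrite addr_ge0// mulr_ge0// subr_ge0.
Qed.

Lemma Kfun_ge0 f p : Omega1 R p -> (forall q, 0 <= f q) -> 0 <= Kfun f p.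
Proof.
move=> Op f0; have [p0 _ _ _] := Omega1_facts Op.
have [/andP[? _] /andP[? _]] := (hbm, hbs).
by rewrite !adde_ge0// mule_ge0 ?merge_sum_ge0 ?split_sum_ge0 ?stay_coef_ge0
  ?lee_fin ?mulr_ge0// ltW.
Qed.

Lemma le_Kfun f g p : Omega1 R p -> (forall q, 0 <= f q) ->
  (forall q, f q <= g q) -> Kfun f p <= Kfun g p.
Proof.
move=> Op f0 fg; have [p0 _ _ _] := Omega1_facts Op.
have [/andP[? _] /andP[? _]] := (hbm, hbs).
rewrite !leeD// lee_wpmul2l ?le_merge_sum ?le_split_sum ?stay_coef_ge0//
  lee_fin ?mulr_ge0// ltW//.
Qed.

Lemma Kfun_superlinear r f g p : Omega1 R p -> (0 <= r)%R ->
  (forall q, 0 <= f q) -> (forall q, 0 <= g q) ->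
  r%:E * Kfun f p + Kfun g p <= Kfun (fun q => r%:E * f q + g q) p.
Proof.
move=> Op r0 f0 g0; have [p0 _ _ _] := Omega1_facts Op.
have [/andP[bm0 _] /andP[bs0 _]] := (hbm, hbs).
have c0 := stay_coef_ge0 Op.
have m0 : 0 <= (2 * bm)%:E by rewrite lee_fin mulr_ge0// ltW.
have s0 : 0 <= bs%:E by rewrite lee_fin ltW.
have rE : 0 <= r%:E by rewrite lee_fin.
rewrite /Kfun; set c := 1 - _ + _ in c0 *.
rewrite !ge0_muleDr ?adde_ge0 ?mule_ge0 ?merge_sum_ge0 ?split_sum_ge0//.
rewrite addeACA (addeACA (r%:E * _)); apply: leeD; [apply: leeD|].
- rewrite muleCA -ge0_muleDr ?mule_ge0 ?merge_sum_ge0// lee_wpmul2l//.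
  exact: merge_sum_superlinear.
- rewrite muleCA -ge0_muleDr ?mule_ge0 ?split_sum_ge0// lee_wpmul2l//.
  exact: split_sum_superlinear.
- by rewrite muleCA.
Qed.

Import HBNNSimple.

Variable mu : probability (borel (Omega1_type R)) R.
Hypothesis hmu : K_invariant sigma bm bs mu.

Lemma val1_Omega1 (p : Omega1_type R) : Omega1 R (val1 p).
Proof. by case: p => p Op; exact: set_mem Op. Qed.

(** For a simple function h <= f, invariance applies to each level set of h,
    and superadditivity of the integral and of [Kfun] bounds the resulting sum
    by the integral of [Kfun f]. *)
Lemma K_invariant_le f : (forall q, 0 <= f q) ->
  \int[mu]_p f (val1 p) <= \int[mu]_p Kfun f (val1 p).
Proof.
move=> f0; rewrite ge0_integralTE//; apply: ge_ereal_sup => _ [h /= hf <-].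
rewrite sintegralE fsbig_finite//=.
set s := fset_set (range h).
pose ind x q : \bar R := dirac_seqs q (@val1 R @` (h @^-1` [set x])).
have ind0 x q : 0 <= ind x q by rewrite /ind /dirac_seqs diracE lee_fin.
have hs : forall x, x \in s -> (0 <= x)%R.
  by move=> x; rewrite in_fset_set// => /set_mem[t _ <-].
have simple0 (l : seq R) q : (forall x, x \in l -> (0 <= x)%R) ->
    0 <= \sum_(x <- l) x%:E * ind x q.
  move=> l0; rewrite big_seq sume_ge0// => x xl.
  by apply: mule_ge0 => //; rewrite lee_fin l0.
(* At a point of Omega1 exactly one level set contributes; elsewhere none does. *)
have simplef q : \sum_(x <- s) x%:E * ind x q <= f q.
  have [[p _ <-]|nq] := pselect ((@val1 R @` setT) q); last first.
    rewrite big1 ?f0// => x _; rewrite /ind /dirac_seqs diracE memNset ?mule0//.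
    by move=> [p _ pq]; apply: nq; exists p.
  have hp : h p \in s by rewrite in_fset_set//; apply: mem_set; exists p.
  rewrite (bigD1_seq (h p)) ?fset_uniq//= big1 ?adde0 => [|x xhp].
    by rewrite /ind /dirac_seqs diracE mem_set ?mule1 ?hf//; exists p.
  rewrite /ind /dirac_seqs diracE memNset ?mule0// => -[p' /= hp' /val_inj pp'].
  by move: xhp; rewrite -hp' pp' eqxx.
apply: (@le_trans _ _ (\int[mu]_p \sum_(x <- s) x%:E * Kfun (ind x) (val1 p))).
  have : forall x, x \in (s : seq R) -> (0 <= x)%R by exact: hs.
  elim: (s : seq R) => [|x l IH] l0.
    by rewrite big_nil; apply: integral_ge0 => p _; rewrite big_nil.
  have x0 : (0 <= x)%R by rewrite l0 ?mem_head.
  have {}l0 y : y \in l -> (0 <= y)%R by move=> yl; rewrite l0// inE yl orbT.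
  have K0 y (p : Omega1_type R) : 0 <= Kfun (ind y) (val1 p).
    by apply: Kfun_ge0 => //; exact: val1_Omega1.
  rewrite big_cons; under [leRHS]eq_integral do rewrite big_cons.
  apply: (le_trans _ (lower_integralD _ _ _)); last 2 first.
  - by move=> p _; apply: mule_ge0 => //; rewrite lee_fin.
  - move=> p _; rewrite big_seq sume_ge0// => y yl.
    by apply: mule_ge0 => //; rewrite lee_fin l0.
  apply: leeD (IH l0).
  apply: (le_trans _ (lower_integralZl _ _ _)) => //.
  rewrite lee_wpmul2l ?lee_fin// -hmu//.
apply: le_lower_integral => [p _|p _].
  rewrite big_seq sume_ge0// => x xs; apply: mule_ge0; first by rewrite lee_fin hs.
  by apply: Kfun_ge0 => //; exact: val1_Omega1.
have Op := val1_Omega1 p.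
apply: (le_trans _ (le_Kfun Op _ simplef)); last by move=> q; exact: simple0.
have : forall x, x \in (s : seq R) -> (0 <= x)%R by exact: hs.
elim: (s : seq R) => [|x l IH] l0.
  by rewrite big_nil Kfun_ge0// => q; rewrite big_nil.
have x0 : (0 <= x)%R by rewrite l0 ?mem_head.
have {}l0 y : y \in l -> (0 <= y)%R by move=> yl; rewrite l0// inE yl orbT.
rewrite big_cons; apply: (le_trans (leeD2l _ (IH l0))).
have -> : (fun q => \sum_(y <- x :: l) y%:E * ind y q) =
    (fun q => x%:E * ind x q + \sum_(y <- l) y%:E * ind y q).
  by apply/funext => q; rewrite big_cons.
by apply: Kfun_superlinear => // q; exact: simple0.
Qed.

(** Boundedness of f makes its integral finite, so it cancels from
    int f + c mu(A) <= int (Kf + c 1_A) <= int f + D. *)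
Lemma drift_inequality f (B c D : R) (A : set (borel (Omega1_type R))) :
  (forall q, 0 <= f q) -> (forall p : Omega1_type R, f (val1 p) <= B%:E) ->
  measurable_fun setT (fun p : borel (Omega1_type R) => f (val1 p)) ->
  measurable A -> (0 <= c)%R -> (0 <= D)%R ->
  (forall p : Omega1_type R, A p -> Kfun f (val1 p) + c%:E <= f (val1 p) + D%:E) ->
  (forall p : Omega1_type R, ~ A p -> Kfun f (val1 p) <= f (val1 p) + D%:E) ->
  c%:E * mu A <= D%:E.
Proof.
move=> f0 fB mf mA c0 D0 KA KnA.
have muc (r : R) : \int[mu]_p r%:E = r%:E.
  rewrite integral_cst// [X in _ * X](_ : _ = 1) ?mule1//.
  exact: probability_setT.
have If : \int[mu]_p f (val1 p) \is a fin_num.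
  rewrite ge0_fin_numE ?integral_ge0//.
  apply: (@le_lt_trans _ _ (\int[mu]_p B%:E)).
    exact: le_lower_integral.
  by rewrite muc ltry.
rewrite -(leeD2lE _ _ If).
have -> : \int[mu]_p f (val1 p) + D%:E = \int[mu]_p (f (val1 p) + D%:E).
  rewrite ge0_integralD//.
  by rewrite muc.
have <- : \int[mu]_p (c%:E * (\1_A p)%:E) = c%:E * mu A.
  rewrite ge0_integralZl//; first by rewrite integral_indic// setIT.
  by apply/measurable_EFinP; exact: measurable_indic.
apply: le_trans.
  by apply: leeD2r; exact: K_invariant_le.
apply: le_trans; first apply: lower_integralD.
- by move=> p _; apply: Kfun_ge0 => //; exact: val1_Omega1.
- by move=> p _; rewrite -EFinM lee_fin mulr_ge0.
apply: le_lower_integral => p _.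
  rewrite adde_ge0 ?Kfun_ge0 -?EFinM ?lee_fin ?mulr_ge0//; exact: val1_Omega1.
rewrite indicE; have [Ap|nAp] := pselect (A p).
  by rewrite mem_set// mule1; exact: KA.
by rewrite memNset// mule0 adde0; exact: KnA.
Qed.

End kernel_on_functions.

(** * Total masses and a pointwise drift bound *)

Section drift_bound.
Context (R : realType).
Implicit Types (p q : seqs R).

Lemma Omega1_sum_le1 p n : Omega1 R p -> \sum_(0 <= k < n) p k <= 1.
Proof.
move=> /Omega1_facts[p0 _ p1 _]; rewrite -lee_fin -sumEFin -p1.
by apply: nneseries_lim_ge => *; rewrite lee_fin.
Qed.

Lemma pairs_and_squares p n :
  \sum_(0 <= j < n) (2 * \sum_(i < j) p i * p j + p j ^+ 2) =
  (\sum_(0 <= k < n) p k) ^+ 2.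
Proof.
elim: n => [|n IH]; first by rewrite !big_geq// expr0n.
rewrite !big_nat_recr//= IH -mulr_suml big_mkord; ring.
Qed.

(** The unordered pairs carry mass at most (1 - |p|_2^2) / 2, by expanding the
    square of the partial sums; this is why the kernel has total mass at most
    one. *)
Lemma pair_mass p s : Omega1 R p -> norm2sq p = s%:E ->
  exists2 P : R, (\sum_(j <oo) (\sum_(i < j) p i * p j)%:E)%E = P%:E &
    0 <= P /\ 2 * P + s <= 1.
Proof.
move=> Op ps; have [p0 _ _ _] := Omega1_facts Op.
have w0 j : 0 <= \sum_(i < j) p i * p j by apply: sumr_ge0 => i _; exact: mulr_ge0.
set S := (\sum_(j <oo) _)%E.
have S0 : (0 <= S)%E by apply: nneseries_ge0 => *; rewrite lee_fin.
have Ss : (2%:E * S + s%:E <= 1)%E.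
  rewrite -ps /norm2sq -nneseriesZl => [|*]; last by rewrite lee_fin.
  rewrite -nneseriesD => [|*|*]; last 2 first.
  - by rewrite -EFinM lee_fin mulr_ge0.
  - by rewrite lee_fin sqr_ge0.
  apply: lime_le.
    apply: is_cvg_nneseries => *.
    by rewrite -EFinM -EFinD lee_fin addr_ge0 ?mulr_ge0 ?sqr_ge0.
  apply: nearW => n; under eq_bigr do rewrite -EFinM -EFinD.
  rewrite sumEFin lee_fin pairs_and_squares expr_le1 ?Omega1_sum_le1//.
  exact: sumr_ge0.
have Sfin : S \is a fin_num.
  rewrite ge0_fin_numE//; rewrite ltey; apply: contraTneq Ss => ->.
  by rewrite mulry gtr0_sg// mul1e addye// -ltNge ltry.
exists (fine S); first by rewrite fineK.
by rewrite -!lee_fin EFinD EFinM fineK.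
Qed.

Local Open Scope ereal_scope.

Lemma series_drift (x : nat -> \bar R) (a w e : nat -> R) (al W el F : R) :
  (forall i, 0 <= x i) -> (forall i, 0 <= a i)%R -> (forall i, 0 <= w i)%R ->
  (forall i, 0 <= e i)%R -> (0 <= F)%R ->
  (forall i, x i + (a i)%:E <= (w i * F + e i)%:E) ->
  al%:E <= \sum_(i <oo) (a i)%:E -> \sum_(i <oo) (w i)%:E = W%:E ->
  \sum_(i <oo) (e i)%:E <= el%:E ->
  \sum_(i <oo) x i + al%:E <= (W * F + el)%:E.
Proof.
move=> x0 a0 w0 e0 F0 xa aal wW eel.
apply: le_trans; first by apply: leeD2l; exact: aal.
rewrite -nneseriesD => [|*|*]; [|exact: x0|by rewrite lee_fin].
apply: (@le_trans _ _ (\sum_(i <oo) (F%:E * (w i)%:E + (e i)%:E))).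
  apply: lee_nneseries => [i _ _|i _]; first by rewrite adde_ge0// lee_fin.
  by rewrite -EFinM -EFinD mulrC.
rewrite nneseriesD => [|*|*]; [|by rewrite -EFinM lee_fin mulr_ge0|by rewrite lee_fin].
rewrite nneseriesZl => [|*]; last by rewrite lee_fin.
by rewrite wW EFinD EFinM muleC leeD2l.
Qed.

Variables (sigma : probability R R) (bm bs : R).
Hypothesis hbm : (0 < bm <= 1)%R.
Hypothesis hbs : (0 < bs <= 1)%R.

(** Here F is the value of the potential at p; a and a' are drops caused by
    merges and splits, weighted by the probabilities of these moves, and e and
    e' are weighted rises.  Comparing each move with staying at p, the F-terms
    sum to at most F because the kernel has total mass at most one. *)
Lemma Kfun_drift (f : seqs R -> \bar R) p (F : R) (a e : nat -> nat -> R)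
    (a' e' : nat -> R) (al el al' el' : R) :
  Omega1 R p -> (forall q, 0 <= f q) -> f p = F%:E ->
  (forall i j, 0 <= a i j)%R -> (forall i j, 0 <= e i j)%R ->
  (forall i, 0 <= a' i)%R -> (forall i, 0 <= e' i)%R ->
  (forall i j, (i < j)%N ->
    (p i * p j)%:E * f (mergep i j p) + (a i j)%:E <= (p i * p j * F + e i j)%:E) ->
  (forall i, (p i ^+ 2)%:E * \int[sigma]_(u in half_interval R) f (splitp i u p)
    + (a' i)%:E <= (p i ^+ 2 * F + e' i)%:E) ->
  al%:E <= \sum_(j <oo) (\sum_(i < j) a i j)%:E ->
  \sum_(j <oo) (\sum_(i < j) e i j)%:E <= el%:E ->
  al'%:E <= \sum_(i <oo) (a' i)%:E -> \sum_(i <oo) (e' i)%:E <= el'%:E ->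
  Kfun sigma bm bs f p + (2 * bm * al + bs * al')%:E <=
    F%:E + (2 * bm * el + bs * el')%:E.
Proof.
move=> Op f0 fF a0 e0 a'0 e'0 hM hS hal hel hal' hel'.
have [p0 _ _ _] := Omega1_facts Op.
have F0 : (0 <= F)%R by rewrite -lee_fin -fF.
have [s sE /andP[s0 s1]] := norm2sq_Omega1 Op.
have [P PE [P0 Ps]] := pair_mass Op sE.
have HM : merge_sum f p + al%:E <= (P * F + el)%:E.
  apply: (series_drift _ _ _ _ F0 _ hal PE hel).
  - by move=> j; exact: merge_term_ge0.
  - by move=> j; exact: sumr_ge0.
  - by move=> j; apply: sumr_ge0 => i _; rewrite mulr_ge0.
  - by move=> j; exact: sumr_ge0.
  move=> j; rewrite -sumEFin -big_split/= mulr_suml -big_split/= -sumEFin.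
  by apply: lee_sum => i _; exact: hM.
have HS : split_sum sigma f p + al'%:E <= (s * F + el')%:E.
  apply: (series_drift _ _ _ _ F0 _ hal' sE hel') => //.
  - by move=> j; exact: split_term_ge0.
  - by move=> j; exact: sqr_ge0.
have M0 := merge_sum_ge0 p0 f0; have S0 := split_sum_ge0 sigma p f0.
have Mfin : merge_sum f p \is a fin_num.
  rewrite ge0_fin_numE// ltey; apply: contraTneq HM => ->.
  by rewrite addye// -ltNge ltry.
have Sfin : split_sum sigma f p \is a fin_num.
  rewrite ge0_fin_numE// ltey; apply: contraTneq HS => ->.
  by rewrite addye// -ltNge ltry.
rewrite /Kfun (stay_coefE bm bs Op sE) fF.
move: HM HS; rewrite -(fineK Mfin) -(fineK Sfin) -!EFinM -!EFinD !lee_fin.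
set x := fine _; set y := fine _ => HM HS.
have [/andP[bm0 _] /andP[bs0 _]] := (hbm, hbs).
have H1 : (2 * bm * (x + al) <= 2 * bm * (P * F + el))%R.
  by rewrite ler_wpM2l// mulr_ge0// ltW.
have H2 : (bs * (y + al') <= bs * (s * F + el'))%R by rewrite ler_wpM2l// ltW.
have H3 : (bm * F * (2 * P + s) <= bm * F * 1)%R.
  by rewrite ler_wpM2l// mulr_ge0// ltW.
lra.
Qed.

End drift_bound.

(** * Sums over the parts *)

Section part_sums.
Context (R : realType) (phi : R -> R).
Implicit Types (p q : seqs R).
Hypothesis phi0 : forall x, 0 <= phi x.

Definition part_sum q : \bar R := (\sum_(k <oo) (phi (q k))%:E)%E.

Lemma part_sum_ge0 q : (0 <= part_sum q)%E.
Proof. by apply: nneseries_ge0 => *; rewrite lee_fin. Qed.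

Lemma part_sum_leP q (x : R) :
  reflect (forall n, \sum_(0 <= k < n) phi (q k) <= x) (part_sum q <= x%:E)%E.
Proof.
apply: (iffP idP) => [h n|h].
  rewrite -lee_fin -sumEFin; apply: le_trans h.
  by apply: nneseries_lim_ge => *; rewrite lee_fin.
apply: lime_le; first by apply: is_cvg_nneseries => *; rewrite lee_fin.
by apply: nearW => n; rewrite sumEFin lee_fin.
Qed.

(** Inserting v shifts the smaller entries, so the first n + 1 terms of the
    new sequence are those of the old one and v, less the one pushed out, which
    is the minimum of v and the n-th entry. *)
Lemma part_sum_insertp v q x : noninc_seq q -> (part_sum q <= x%:E)%E ->
  (part_sum (insertp v q) <= (x + phi v)%:E)%E.
Proof.
move=> dq /part_sum_leP qx; apply/part_sum_leP.
have E n : \sum_(0 <= k < n.+1) phi (insertp v q k) =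
    phi v + \sum_(0 <= k < n.+1) phi (q k) - phi (Num.min v (q n)).
  elim: n => [|n IH].
    by rewrite !big_nat1 /=; case: (leP v (q 0%N)) => ?; lra.
  rewrite big_nat_recr//= IH [in RHS]big_nat_recr//=.
  have := dq _ _ (leqnSn n).
  case: (leP v (q n)) => ?; case: (leP v (q n.+1)) => ? /=;
    case: leP => ? ?; lra.
case=> [|n]; first by rewrite big_geq// addr_ge0//; have := qx 0%N; rewrite big_geq.
by rewrite E; have := qx n.+1; have := phi0 (Num.min v (q n)); lra.
Qed.

Lemma part_sum_removep i q x : (part_sum q <= x%:E)%E ->
  (part_sum (removep i q) <= (x - phi (q i))%:E)%E.
Proof.
move=> /part_sum_leP qx; apply/part_sum_leP.
have E n : (i <= n)%N -> \sum_(0 <= k < n) phi (removep i q k) =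
    \sum_(0 <= k < n.+1) phi (q k) - phi (q i).
  move=> /subnK <-; elim: (n - i)%N => [|d IH].
    rewrite add0n big_nat_recr//= addrK; apply: eq_big_nat => k /andP[_ ki].
    by rewrite /removep /bump leqNgt ki.
  rewrite addSn big_nat_recr//= IH [in RHS]big_nat_recr//= addrAC.
  by rewrite /removep /bump leq_addl add1n.
move=> n; apply: (@le_trans _ _ (\sum_(0 <= k < maxn i n) phi (removep i q k))).
  rewrite [leRHS](big_cat_nat _ (leq_maxr i n))//= lerDl.
  exact: sumr_ge0.
by rewrite E ?leq_maxl// lerD2r.
Qed.

Lemma part_sum_mergep i j p x : (i < j)%N -> noninc_seq p ->
  (part_sum p <= x%:E)%E ->
  (part_sum (mergep i j p) <= (x - phi (p i) - phi (p j) + phi (p i + p j))%:E)%E.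
Proof.
move=> ij dp px; rewrite /mergep (minn_idPl (ltnW ij)) (maxn_idPr (ltnW ij)).
apply: part_sum_insertp; first by do 2 apply: noninc_removep.
have := part_sum_removep i (part_sum_removep j px).
rewrite [removep j p i](_ : _ = p i) 1?addrAC//.
by rewrite /removep /bump leqNgt ij.
Qed.

Lemma part_sum_splitp i u p x : noninc_seq p -> (part_sum p <= x%:E)%E ->
  (part_sum (splitp i u p) <=
    (x - phi (p i) + phi ((1 - u) * p i) + phi (u * p i))%:E)%E.
Proof.
move=> dp px; have dr := noninc_removep i dp.
by apply: part_sum_insertp (noninc_insertp _ dr) _;
  apply: part_sum_insertp dr _; exact: part_sum_removep.
Qed.

End part_sums.

(** * A bounded version of the inverse *)

Section phi.
Context (R : realType) (eps : R).
Hypothesis eps0 : 0 < eps.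

(** The absolute value keeps phi nonnegative on arbitrary sequences; only
    nonnegative arguments matter. *)
Definition phi (x : R) : R := `|x| / (x ^+ 2 + eps ^+ 2).

Let den_gt0 (x : R) : 0 < x ^+ 2 + eps ^+ 2.
Proof. by rewrite ltr_wpDl ?sqr_ge0// exprn_gt0. Qed.

Lemma phi_ge0 x : 0 <= phi x.
Proof. by rewrite divr_ge0// ltW. Qed.

Lemma phi_le_linear x : 0 <= x -> phi x <= x / eps ^+ 2.
Proof.
move=> x0; rewrite /phi ger0_norm// ler_wpM2l// lef_pV2 ?posrE ?den_gt0 ?exprn_gt0//.
by rewrite lerDr sqr_ge0.
Qed.

Lemma phi_le_inv x : 0 < x -> phi x <= x^-1.
Proof.
move=> x0; rewrite /phi gtr0_norm// ler_pdivrMr//.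
by rewrite mulrDr expr2 mulKf ?gt_eqF// lerDl mulr_ge0// ?invr_ge0 ?sqr_ge0// ltW.
Qed.

Let g_le (x y : R) : 0 <= x -> x <= y ->
  (y ^+ 2 + eps ^+ 2)^-1 <= (x ^+ 2 + eps ^+ 2)^-1.
Proof.
move=> x0 xy; rewrite lef_pV2 ?posrE ?den_gt0// lerD2r.
by rewrite lerXn2r ?nnegrE// (le_trans x0).
Qed.

(** phi(x) is x times a decreasing function of x. *)
Lemma phi_subadditive x y : 0 <= x -> 0 <= y -> phi (x + y) <= phi x + phi y.
Proof.
move=> x0 y0; rewrite /phi !ger0_norm ?addr_ge0// mulrDl.
by apply: lerD; rewrite ler_wpM2l// g_le// ?lerDl ?lerDr.
Qed.

(** With g(x) = phi(x) / x, the loss is at least y (g(y) - g(x + y)), hence at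
    least y (g(y) - g(2 y)); for y >= eps the two denominators in g are at most
    2 y^2 and 5 y^2, whence 3 y^2 / (10 y^4) for g(y) - g(2 y). *)
Lemma phi_merge_loss x y : eps <= y -> y <= x ->
  3 / 10 <= y * (phi x + phi y - phi (x + y)).
Proof.
move=> ey yx; have y0 : 0 < y by apply: lt_le_trans ey.
have x0 : 0 < x by apply: lt_le_trans yx.
rewrite /phi !gtr0_norm ?addr_gt0//.
set G := fun z : R => (z ^+ 2 + eps ^+ 2)^-1.
rewrite -/(G x) -/(G y) -/(G (x + y)).
have h1 : G (x + y) <= G x by apply: g_le; [exact: ltW|rewrite lerDl ltW].
have h2 : G (x + y) <= G (2 * y) by apply: g_le; lra.
have h3 : 3 / 10 <= y * (y * (G y - G (2 * y))).
  rewrite /G.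
  have e2 : eps ^+ 2 <= y ^+ 2 by rewrite lerXn2r ?nnegrE// ltW.
  have e20 : 0 < eps ^+ 2 by rewrite exprn_gt0.
  have y20 : 0 < y ^+ 2 by rewrite exprn_gt0.
  have d1 := den_gt0 y; have d2 := den_gt0 (2 * y).
  have -> : y * (y * ((y ^+ 2 + eps ^+ 2)^-1 - ((2 * y) ^+ 2 + eps ^+ 2)^-1)) =
      3 * (y ^+ 2) ^+ 2 / ((y ^+ 2 + eps ^+ 2) * ((2 * y) ^+ 2 + eps ^+ 2)).
    by field; rewrite !gt_eqF.
  rewrite ler_pdivlMr ?mulr_gt0// exprMn.
  have : (y ^+ 2 + eps ^+ 2) * (2 ^+ 2 * y ^+ 2 + eps ^+ 2) <=
      (2 * y ^+ 2) * (5 * y ^+ 2).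
    by apply: ler_pM; move: e2 e20 y20; move: (y ^+ 2) (eps ^+ 2) => Y E; lra.
  rewrite (_ : (2 * y ^+ 2) * (5 * y ^+ 2) = 10 * (y ^+ 2) ^+ 2); last by ring.
  by move: (_ * _) (_ ^+ 2 ^+ 2) => A B; lra.
apply: (le_trans h3); apply: ler_wpM2l; first exact: ltW.
have h4 : 0 <= x * (G x - G (x + y)) by rewrite mulr_ge0 ?subr_ge0// ltW.
have h5 : 0 <= y * (G (2 * y) - G (x + y)) by rewrite mulr_ge0 ?subr_ge0// ltW.
by move: h4 h5; move: (G x) (G y) (G (x + y)) (G (2 * y)) => a b c d; lra.
Qed.

Lemma phi_continuous : continuous phi.
Proof.
move=> x; apply: cvgM; first exact: norm_continuous.
apply: cvgV; first by rewrite gt_eqF.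
by apply: cvgD; [exact: exprn_continuous|exact: cvg_cst].
Qed.

Lemma measurable_phi : measurable_fun setT phi.
Proof. by apply: continuous_measurable_fun; exact: phi_continuous. Qed.

End phi.

(** * Measurability of the coordinates *)

Section coordinates.
Context (R : realType).

Lemma measurable_part k :
  measurable_fun setT (fun p : borel (Omega1_type R) => val1 p k).
Proof.
have cont : continuous (fun p : Omega1_type R => val1 p k).
  move=> p; apply: (@continuous_comp _ _ _ (@val1 R) (fun q : seqs R => q k)).
    exact: initial_continuous.
  exact: (@proj_continuous nat (fun=> R) k).
apply: (measurability _ (RGenOpens.measurableE R)) => _ [_ [x [y ->]] <-].
rewrite setTI; apply: sub_sigma_algebra.
by move/continuousP : cont; apply; exact: interval_open.
Qed.

End coordinates.

Section measurable_parts.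
Context (R : realType).

Lemma measurable_part_ge k (x : R) :
  measurable ([set p | x <= val1 p k] : set (borel (Omega1_type R))).
Proof.
have := @measurable_part R k measurableT _ (measurable_itv `[x, +oo[).
rewrite setTI; congr measurable; apply/seteqP; split=> p /=;
  by rewrite in_itv/= andbT.
Qed.

Lemma measurable_part_eq0 k :
  measurable ([set p | val1 p k = 0] : set (borel (Omega1_type R))).
Proof.
have := @measurable_part R k measurableT _ (measurable_set1 (0 : R)).
by rewrite setTI.
Qed.

Lemma measurable_finitely_many_parts : measurable (finitely_many_parts R).
Proof.
have -> : finitely_many_parts R = \bigcup_k [set p | val1 p k.+1 = 0].
  apply/seteqP; split=> [p [[|k] [+ pk]]|p [k _ pk]] => //; first by exists k.
  by exists k.+1.
by apply: bigcupT_measurable => k; exact: measurable_part_eq0.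
Qed.

Lemma measurable_part_sum (phi : R -> R) : (forall x, 0 <= phi x) ->
  measurable_fun setT phi ->
  measurable_fun setT
    (fun p : borel (Omega1_type R) => part_sum phi (val1 p)).
Proof.
move=> phi0 mphi; apply: (ge0_emeasurable_sum (P := xpredT)) => [k p _ _|k _].
  by rewrite lee_fin.
by apply/measurable_EFinP; apply: measurableT_comp => //; exact: measurable_part.
Qed.

End measurable_parts.

(** * Finite inverse moment *)

Section finite_inverse_moment.
Context (R : realType) (sigma : probability R R).
Hypothesis hsigma : sigma (half_interval R) = 1%E.
Variables (bm bs : R).
Hypothesis hbm : 0 < bm <= 1.
Hypothesis hbs : 0 < bs <= 1.
Implicit Types (p q : seqs R).

Lemma measurable_half : measurable (half_interval R).
Proof. exact: measurable_itv. Qed.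

Lemma measurable_inv_half :
  measurable_fun (half_interval R) (fun u : R => u^-1).
Proof.
apply: (@measurable_funS _ _ _ _ (`]0, +oo[ : set R)); first exact: measurable_itv.
  by move=> u; rewrite /half_interval/= !in_itv/= andbT => /andP[].
apply: open_continuous_measurable_fun; first exact: interval_open.
move=> u /set_mem; rewrite /= in_itv/= andbT => u0.
by apply: inv_continuous; rewrite gt_eqF.
Qed.

Lemma integral_half_cst (r : R) : (\int[sigma]_(u in half_interval R) r%:E = r%:E)%E.
Proof.
rewrite integral_cst//; last exact: measurable_half.
by rewrite [X in (_ * X)%E](_ : _ = 1%E) ?mule1.
Qed.

(** The probability p_i^2 of the split compensates the new values
    phi(u p_i) <= 1/(u p_i) and phi((1 - u) p_i) <= 2/p_i, leaving a gain
    proportional to p_i, which is summable. *)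
Lemma split_gain (eps C F : R) p i : 0 < eps -> Omega1 R p ->
  (\int[sigma]_(u in half_interval R) (u^-1)%:E = C%:E)%E ->
  part_sum (phi eps) p = F%:E ->
  ((p i ^+ 2)%:E * \int[sigma]_(u in half_interval R)
     part_sum (phi eps) (splitp i u p) <= (p i ^+ 2 * F + p i * (C + 2))%:E)%E.
Proof.
move=> e0 Op IC pF; have [p0 dp _ _] := Omega1_facts Op.
have [pi0|pin0] := eqVneq (p i) 0.
  by rewrite pi0 expr0n/= mul0e !mul0r addr0.
have pi0 : 0 < p i by rewrite lt_neqAle eq_sym pin0 p0.
set x := p i in pi0 pin0 *.
have F0 : 0 <= F by rewrite -lee_fin -pF part_sum_ge0// => ?; exact: phi_ge0.
have I : (\int[sigma]_(u in half_interval R) part_sum (phi eps) (splitp i u p)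
    <= (F + 2 / x)%:E + (x^-1)%:E * C%:E)%E.
  apply: (@le_trans _ _ (\int[sigma]_(u in half_interval R)
      ((F + 2 / x)%:E + (x^-1)%:E * (u^-1)%:E))%E).
    apply: le_lower_integral => [u _|u].
      by apply: part_sum_ge0 => ?; exact: phi_ge0.
    rewrite /half_interval /= in_itv/= => /andP[u0 u1].
    apply: (le_trans (part_sum_splitp (phi_ge0 e0) i u dp (_ : _ <= F%:E)%E)).
      by rewrite pF.
    rewrite -EFinM -EFinD lee_fin -/x.
    have h1 := phi_ge0 e0 x.
    have v0 : 0 < 1 - u by lra.
    have h2 : phi eps (u * x) <= u^-1 * x^-1.
      by rewrite -invfM; apply: phi_le_inv => //; rewrite mulr_gt0.
    have h3 : phi eps ((1 - u) * x) <= 2 / x.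
      apply: (le_trans (phi_le_inv e0 _)); first by rewrite mulr_gt0.
      rewrite invfM; apply: ler_wpM2r; first by rewrite invr_ge0 ltW.
      rewrite -[leRHS]invrK lef_pV2 ?posrE ?invr_gt0//; lra.
    lra.
  rewrite ge0_integralD//=; last 4 first.
  - exact: measurable_half.
  - by move=> u _; rewrite lee_fin addr_ge0// divr_ge0// ltW.
  - move=> u; rewrite /half_interval/= in_itv/= => /andP[u0 _].
    by rewrite -EFinM lee_fin mulr_ge0// invr_ge0 ltW.
  - apply/measurable_EFinP; apply: measurable_funM => //.
    exact: measurable_inv_half.
  rewrite integral_half_cst ge0_integralZl ?IC//=.
  - exact: measurable_half.
  - by apply/measurable_EFinP; exact: measurable_inv_half.
  - move=> u; rewrite /half_interval/= in_itv/= => /andP[u0 _].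
    by rewrite lee_fin invr_ge0 ltW.
  - by rewrite lee_fin invr_ge0 ltW.
apply: le_trans; first by apply: lee_wpmul2l I; rewrite lee_fin sqr_ge0.
rewrite -!EFinM lee_fin.
by rewrite le_eqVlt; apply/orP; left; apply/eqP; field.
Qed.

Definition first_and_last_ge (d e : R) (n : nat) : set (borel (Omega1_type R)) :=
  [set p | d <= val1 p 0%N /\ e <= val1 p n].

Variable mu : probability (borel (Omega1_type R)) R.
Hypothesis hmu : K_invariant sigma bm bs mu.

(** The bound does not depend on eps, and its left-hand side grows linearly
    in n: on this event the largest part can merge with n parts of size at
    least eps, each lowering the potential at rate at least
    2 bm (3/10) p_0. *)
Lemma first_and_last_bound (d eps C : R) n : 0 < d -> 0 < eps ->
  (\int[sigma]_(u in half_interval R) (u^-1)%:E = C%:E)%E ->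
  ((2 * bm * (3 / 10 * d * n%:R))%:E * mu (first_and_last_ge d eps n) <=
    (bs * (C + 2))%:E)%E.
Proof.
move=> d0 e0 IC.
have [/andP[bm0 _] /andP[bs0 _]] := (hbm, hbs).
have C0 : 0 <= C.
  rewrite -lee_fin -IC; apply: integral_ge0 => u.
  rewrite /half_interval/= in_itv/= => /andP[u0 _].
  by rewrite lee_fin invr_ge0 ltW.
have ph0 := phi_ge0 e0.
have fle p : Omega1 R p -> (part_sum (phi eps) p <= ((eps ^+ 2)^-1)%:E)%E.
  move=> Op; have [p0 _ _ _] := Omega1_facts Op.
  apply/part_sum_leP => // m.
  apply: (@le_trans _ _ (\sum_(0 <= k < m) p k / eps ^+ 2)).
    by apply: ler_sum => k _; exact: phi_le_linear.
  rewrite -mulr_suml ler_piMl ?invr_ge0 ?sqr_ge0//.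
  exact: Omega1_sum_le1.
have key (p : Omega1_type R) (al : R) :
    (al%:E <= \sum_(j <oo) (\sum_(i < j) (val1 p i * val1 p j *
      (phi eps (val1 p i) + phi eps (val1 p j) - phi eps (val1 p i + val1 p j))))%:E)%E ->
    (Kfun sigma bm bs (part_sum (phi eps)) (val1 p) + (2 * bm * al)%:E <=
    part_sum (phi eps) (val1 p) + (bs * (C + 2))%:E)%E.
  move=> hal.
  have Op := val1_Omega1 p; have [p0 dp p1 _] := Omega1_facts Op.
  have pfin : part_sum (phi eps) (val1 p) \is a fin_num.
    by rewrite ge0_fin_numE ?part_sum_ge0// (le_lt_trans (fle _ Op))// ltry.
  set F := fine (part_sum (phi eps) (val1 p)).
  have pF : part_sum (phi eps) (val1 p) = F%:E by rewrite /F fineK.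
  have := @Kfun_drift R sigma bm bs hbm hbs (part_sum (phi eps)) (val1 p) F
    (fun i j => val1 p i * val1 p j *
      (phi eps (val1 p i) + phi eps (val1 p j) - phi eps (val1 p i + val1 p j)))
    (fun _ _ => 0) (fun=> 0) (fun i => val1 p i * (C + 2)) al 0 0 (C + 2)
    Op (part_sum_ge0 ph0) pF.
  rewrite !mulr0 addr0 add0r pF; apply => //.
  - by move=> i j; rewrite !mulr_ge0// subr_ge0 phi_subadditive.
  - by move=> i; rewrite mulr_ge0// addr_ge0.
  - move=> i j ij; have := part_sum_mergep ph0 ij dp (_ : _ <= F%:E)%E.
    rewrite pF => /(_ (lexx _)) h.
    apply: le_trans.
      by apply: leeD2r; apply: lee_wpmul2l h; rewrite lee_fin mulr_ge0.
    by rewrite -EFinM -EFinD lee_fin; lra.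
  - by move=> i; rewrite adde0; exact: split_gain.
  - by rewrite eseries0// => j _ _; rewrite big1.
  - by rewrite eseries0.
  - under eq_eseriesr do rewrite mulrC EFinM.
    rewrite nneseriesZl => [|*]; last by rewrite lee_fin.
    by rewrite [X in (_ * X)%E]p1 mule1.
apply: (drift_inequality hbm hbs hmu (f := part_sum (phi eps)) (B := (eps ^+ 2)^-1)).
- exact: part_sum_ge0.
- by move=> p; apply: fle; exact: val1_Omega1.
- by apply: measurable_part_sum => //; exact: measurable_phi.
- by apply: measurableI; exact: measurable_part_ge.
- by rewrite !mulr_ge0// ?invr_ge0 ltW.
- by rewrite mulr_ge0 ?addr_ge0// ltW.
- move=> p [dp0 epn]; apply: key.
  have Op := val1_Omega1 p; have [p0 dp _ _] := Omega1_facts Op.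
  have a0 i j : 0 <= val1 p i * val1 p j *
      (phi eps (val1 p i) + phi eps (val1 p j) - phi eps (val1 p i + val1 p j)).
    by rewrite !mulr_ge0// subr_ge0 phi_subadditive.
  apply: (le_trans _ (nneseries_lim_ge n.+1 _)); last first.
    by move=> j _ _; rewrite lee_fin sumr_ge0.
  rewrite sumEFin lee_fin big_nat_recl//= big_ord0 add0r.
  have -> : 3 / 10 * d * n%:R = \sum_(0 <= j < n) (3 / 10 * d).
    by rewrite sumr_const_nat subn0 mulr_natr.
  apply: ler_sum_nat => j /andP[_ jn].
  rewrite big_ord_recl/= -[leLHS]addr0 lerD ?sumr_ge0//.
  have ej : eps <= val1 p j.+1 by rewrite (le_trans epn)// dp.
  have := phi_merge_loss e0 ej (dp 0%N j.+1 isT).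
  move=> X0; rewrite -[leRHS]mulrA [leLHS]mulrC.
  move: (val1 p j.+1 * _) X0 => X X0.
  by apply: ler_pM => //; exact: ltW.
- move=> p _; have := key p 0; rewrite mulr0 adde0; apply.
  apply: nneseries_ge0 => j _ _; rewrite lee_fin sumr_ge0// => i _.
  have [p0 _ _ _] := Omega1_facts (val1_Omega1 p).
  by rewrite !mulr_ge0// subr_ge0 phi_subadditive.
Qed.

Lemma mu_finitely_many_parts1 :
  (\int[sigma]_(x in half_interval R) (x^-1)%:E < +oo)%E ->
  mu (finitely_many_parts R) = 1%E.
Proof.
move=> Ioo.
have inv0 u : half_interval R u -> (0 <= (u^-1)%:E)%E.
  by rewrite /half_interval/= in_itv/= => /andP[u0 _]; rewrite lee_fin invr_ge0 ltW.
have [C IC] : exists C : R,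
    (\int[sigma]_(u in half_interval R) (u^-1)%:E = C%:E)%E.
  by eexists; rewrite -[LHS]fineK// ge0_fin_numE// integral_ge0.
have C0 : 0 <= C by rewrite -lee_fin -IC integral_ge0.
have [/andP[bm0 _] /andP[bs0 _]] := (hbm, hbs).
pose inf_parts (d : R) : set (borel (Omega1_type R)) :=
  [set p | d <= val1 p 0%N /\ forall i, val1 p i != 0].
have minf d : measurable (inf_parts d).
  rewrite (_ : inf_parts d = [set p | d <= val1 p 0%N] `&`
      \bigcap_i ~` [set p | val1 p i = 0]).
    apply: measurableI; first exact: measurable_part_ge.
    by apply: bigcapT_measurable => i; apply: measurableC; exact: measurable_part_eq0.
  apply/seteqP; split=> p /= [dp pn]; split=> // i.
    by move=> _; exact/eqP.
  by apply/eqP; exact: pn.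
have bound (d : R) n : 0 < d -> (mu (inf_parts d) <=
    (bs * (C + 2) / (2 * bm * (3 / 10 * d * n.+1%:R)))%:E)%E.
  move=> d0; set c := 2 * bm * _.
  have c0 : 0 < c by rewrite !mulr_gt0// ?invr_gt0.
  (* The lower bound on the last part is removed by monotone continuity. *)
  pose A m := first_and_last_ge d m.+1%:R^-1 n.+1.
  have mA m : measurable (A m) by apply: measurableI; exact: measurable_part_ge.
  have Abound m : (mu (A m) <= (bs * (C + 2) / c)%:E)%E.
    rewrite EFinM lee_pdivlMr// muleC.
    by apply: first_and_last_bound => //; rewrite invr_gt0.
  have mcup : measurable (\bigcup_m A m) by exact: bigcupT_measurable.
  have ndA : {homo A : m k / (m <= k)%N >-> (m <= k)%O}.
    move=> m k mk; apply/subsetPset => p [dp mp]; split=> //.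
    by apply: le_trans mp; rewrite lef_pV2 ?posrE// ler_nat ltnS.
  apply: (@le_trans _ _ (mu (\bigcup_m A m))).
    apply: le_measure; [exact: mem_set|exact: mem_set|].
    move=> p [dp pn]; have [p0 _ _ _] := Omega1_facts (val1_Omega1 p).
    have pn0 : 0 < val1 p n.+1 by rewrite lt_neqAle eq_sym pn p0.
    have [m mp] := ltr_add_invr pn0.
    by exists m => //; split=> //; rewrite add0r in mp; exact: ltW.
  have cv := nondecreasing_cvg_mu (mu := mu) mA mcup ndA.
  rewrite -(cvg_lim (@ereal_hausdorff R) cv)//; apply: lime_le.
    by apply/cvg_ex; eexists; exact: cv.
  by apply: nearW => m; exact: Abound.
have null (d : R) : 0 < d -> mu (inf_parts d) = 0%E.
  move=> d0; apply/eqP; rewrite eq_le measure_ge0 andbT.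
  apply/lee_addgt0Pr => e e0; rewrite add0e.
  set c := bs * (C + 2) / (2 * bm * (3 / 10 * d)).
  have [n cn] : exists n : nat, c / e < n.+1%:R.
    exists (Num.bound `|c / e|); apply: le_lt_trans (ler_norm _) _.
    by apply: lt_le_trans (archi_boundP (normr_ge0 _)) _; rewrite ler_nat.
  apply: (le_trans (bound d n d0)); rewrite lee_fin.
  have -> : bs * (C + 2) / (2 * bm * (3 / 10 * d * n.+1%:R)) = c / n.+1%:R.
    by rewrite /c (mulrA (2 * bm)) [in LHS]invfM [LHS]mulrA.
  by rewrite ler_pdivrMr// mulrC -ler_pdivrMr// ltW.
have mu1 : mu setT = 1%E by exact: probability_setT.
have mS := @measurable_finitely_many_parts R.
have -> : mu (finitely_many_parts R) = (1 - mu (~` finitely_many_parts R))%E.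
  by rewrite probability_setC// oppeB// ?addeA ?subee ?add0e.
rewrite [X in (1 - X)%E](_ : _ = 0%E) ?sube0//.
apply/eqP; rewrite eq_le measure_ge0 andbT.
have : (mu (~` finitely_many_parts R) <= \sum_(k <oo) mu (inf_parts (k.+1%:R^-1)%R))%E.
  apply: measure_sigma_subadditive => //; first exact: measurableC.
  move=> p nS; have [p0 dp p1 _] := Omega1_facts (val1_Omega1 p).
  have pn k : val1 p k.+1 != 0.
    by apply/eqP => pk; apply: nS; exists k.+1.
  have p00 : 0 < val1 p 0%N.
    by apply: (@lt_le_trans _ _ (val1 p 1%N)); [rewrite lt_neqAle eq_sym pn p0|exact: dp].
  have [m mp] := ltr_add_invr p00.
  exists m => //; split; first by rewrite add0r in mp; exact: ltW.
  by case=> [|k]; rewrite ?pn// gt_eqF.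
by rewrite eseries0// => k _ _; apply: null; rewrite invr_gt0.
Qed.

End finite_inverse_moment.

(** * Sequences with finitely many parts *)

Lemma eseries_single (R : realType) (N : nat) (x : R) : 0 <= x ->
  (\sum_(j <oo) (if j == N then x else 0)%:E = x%:E)%E.
Proof.
move=> x0; rewrite (nneseriesD1 (n := N))//; last by move=> k _; case: ifP.
rewrite eqxx eseries0 ?adde0// => j _ /andP[_ jN].
by rewrite (negbTE jN).
Qed.

Section finite_partitions.
Context (R : realType).
Implicit Types (p q : seqs R) (u v : R).

(** Since the sequence is nonincreasing, one zero makes all later entries
    zero. *)
Definition fin_parts q := [/\ nneg_seq q, noninc_seq q & exists n, q n = 0].

Lemma fin_parts_tail q n m : nneg_seq q -> noninc_seq q -> q n = 0 ->
  (n <= m)%N -> q m = 0.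
Proof. by move=> q0 dq qn nm; apply/eqP; rewrite eq_le q0 andbT -qn dq. Qed.

Lemma fin_parts_removep i q : fin_parts q -> fin_parts (removep i q).
Proof.
move=> [q0 dq [n qn]]; split; [exact: nneg_removep|exact: noninc_removep|].
by exists n; apply: (fin_parts_tail q0 dq qn); rewrite /bump leq_addl.
Qed.

Lemma fin_parts_insertp v q : 0 <= v -> fin_parts q -> fin_parts (insertp v q).
Proof.
move=> v0 [q0 dq [n qn]]; split; [exact: nneg_insertp|exact: noninc_insertp|].
exists n.+1; rewrite /= qn (fin_parts_tail q0 dq qn (leqnSn n)).
by rewrite (min_idPr v0) maxxx.
Qed.

Lemma insertp_old v q k : noninc_seq q -> exists k', insertp v q k' = q k.
Proof.
move=> dq; have [vk|kv] := leP v (q k).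
  exists k; case: k vk => [|k] vk /=; first exact: max_idPr.
  by apply/max_idPl; rewrite ge_min vk.
exists k.+1 => /=; rewrite (min_idPr (ltW kv)).
by apply/max_idPr; exact: dq.
Qed.

(** The inserted value sits at the first index whose old entry does not exceed
    it, which exists as the sequence vanishes eventually. *)
Lemma insertp_new v q : 0 <= v -> fin_parts q -> exists k, insertp v q k = v.
Proof.
move=> v0 [_ _ [n qn]].
have exq : exists n, q n <= v by exists n; rewrite qn.
case: (ex_minnP exq) => -[|k] qk mink; first by exists 0%N => /=; exact/max_idPl.
exists k.+1 => /=; have vk : v < q k.
  by rewrite ltNge; apply/negP => /mink; rewrite ltnn.
by rewrite (min_idPl (ltW vk)); exact/max_idPr.
Qed.

(** The two parts removed and k is beyond both, so the k-th entry has moved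
    to index k - 2 before the insertion. *)
Lemma mergep_old i j k p : (i < j)%N -> (j < k)%N -> noninc_seq p ->
  exists k', mergep i j p k' = p k.
Proof.
move=> ij jk dp; rewrite /mergep (minn_idPl (ltnW ij)) (maxn_idPr (ltnW ij)).
have [|k' k'E] := @insertp_old (p i + p j) (removep i (removep j p)) k.-2.
  by do 2 apply: noninc_removep.
exists k'; rewrite k'E; congr p; rewrite /bump; lia.
Qed.

Lemma fin_parts_mergep i j p : fin_parts p -> fin_parts (mergep i j p).
Proof.
move=> fp; have [p0 _ _] := fp.
by apply: fin_parts_insertp; [rewrite addr_ge0|do 2 apply: fin_parts_removep].
Qed.

Lemma fin_parts_splitp i u p : 0 <= u <= 1 -> fin_parts p ->
  fin_parts (splitp i u p).
Proof.
move=> /andP[u0 u1] fp; have [p0 _ _] := fp.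
apply: fin_parts_insertp; first by rewrite mulr_ge0.
apply: fin_parts_insertp; first by rewrite mulr_ge0// subr_ge0.
exact: fin_parts_removep.
Qed.

Lemma splitp_old i k u p : (i < k)%N -> noninc_seq p ->
  exists k', splitp i u p k' = p k.
Proof.
move=> ik dp; have dr := noninc_removep i dp.
have [k1 k1E] := @insertp_old ((1 - u) * p i) (removep i p) k.-1 dr.
have [k2 k2E] := @insertp_old (u * p i) _ k1 (noninc_insertp ((1 - u) * p i) dr).
exists k2; rewrite /splitp k2E k1E; congr p; rewrite /bump; lia.
Qed.

Lemma splitp_new i u p : 0 <= u <= 1 -> fin_parts p ->
  exists k, splitp i u p k = u * p i.
Proof.
move=> /andP[u0 u1] fp; have [p0 _ _] := fp.
apply: insertp_new; first by rewrite mulr_ge0.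
apply: fin_parts_insertp; first by rewrite mulr_ge0// subr_ge0.
exact: fin_parts_removep.
Qed.

Lemma last_part p k : fin_parts p -> 0 < p k ->
  exists N, [/\ (k <= N)%N, 0 < p N & p N.+1 = 0].
Proof.
move=> [p0 dp [n pn]] pk.
have exq : exists n, p n == 0 by exists n; rewrite pn.
case: (ex_minnP exq) => -[|N] /eqP pN minN.
  by move: (dp 0%N k isT); rewrite pN leNgt pk.
exists N; split=> //.
  by rewrite leqNgt; apply/negP => /(fin_parts_tail p0 dp pN) /eqP; rewrite gt_eqF.
by rewrite lt_neqAle eq_sym p0 andbT; apply/negP => /minN; rewrite ltnn.
Qed.

Lemma Omega1_part0_gt0 p : Omega1 R p -> 0 < p 0%N.
Proof.
move=> Op; have [p0 dp p1 _] := Omega1_facts Op.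
rewrite lt_neqAle eq_sym p0 andbT; apply/eqP => p00.
suff : mass p = 0%E by rewrite p1 => /eqP; rewrite onee_eq0.
by rewrite /mass eseries0// => k _ _; rewrite (fin_parts_tail p0 dp p00).
Qed.

End finite_partitions.

(** * The smallest part as a potential *)

Section smallest_part.
Context (R : realType) (eps : R).
Hypothesis eps0 : 0 < eps.
Implicit Types (p q : seqs R).

(** Another bounded version of 1/x, decreasing on x >= 0 and at most 1/eps. *)
Definition trunc_inv (x : R) := (`|x| + eps)^-1.

(** Only the last positive entry of a nonincreasing sequence satisfies the
    test, so the infimum is 1/eps - 1/(m + eps) for the smallest part m, and
    1/eps when there are infinitely many parts.  Writing it as a countable
    infimum over consecutive pairs of entries makes measurability
    immediate. *)
Definition smallest_part_pot q : \bar R :=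
  einfs (fun k => (if (0 < q k) && (q k.+1 == 0)
                   then eps^-1 - trunc_inv (q k) else eps^-1)%:E) 0.

Lemma trunc_inv_ge0 x : 0 <= trunc_inv x.
Proof. by rewrite invr_ge0 addr_ge0// ltW. Qed.

Lemma trunc_inv_le x : trunc_inv x <= eps^-1.
Proof. by rewrite lef_pV2 ?posrE ?ltr_wpDl// lerDr. Qed.

Lemma trunc_inv_noninc x y : 0 <= x -> x <= y -> trunc_inv y <= trunc_inv x.
Proof.
move=> x0 xy; have y0 := le_trans x0 xy.
by rewrite lef_pV2 ?posrE ?ltr_wpDl// lerD2r !ger0_norm.
Qed.

Lemma mul_trunc_inv_le1 x : 0 <= x -> x * trunc_inv x <= 1.
Proof.
move=> x0; rewrite ler_pdivrMr ?ltr_wpDl// mul1r ger0_norm//.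
by rewrite lerDl ltW.
Qed.

Lemma trunc_inv_le_inv x : 0 < x -> trunc_inv x <= x^-1.
Proof.
move=> x0; rewrite lef_pV2 ?posrE ?ltr_wpDl// gtr0_norm//.
by rewrite lerDl ltW.
Qed.

Lemma trunc_inv_continuous : continuous trunc_inv.
Proof.
move=> x; apply: cvgV; first by rewrite gt_eqF// ltr_wpDl.
by apply: cvgD; [exact: norm_continuous|exact: cvg_cst].
Qed.

Lemma smallest_part_pot_ge0 q : (0 <= smallest_part_pot q)%E.
Proof.
apply: le_ereal_inf_tmp => _ [k _ <-]; rewrite lee_fin.
by case: ifP => _; rewrite ?subr_ge0 ?trunc_inv_le ?invr_ge0 ?ltW.
Qed.

Lemma smallest_part_pot_le_term q k : (smallest_part_pot q <=
  (if (0 < q k) && (q k.+1 == 0)%R then eps^-1 - trunc_inv (q k) else eps^-1)%:E)%E.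
Proof. by apply: ereal_inf_lbound; exists k. Qed.

Lemma smallest_part_pot_le_max q : (smallest_part_pot q <= (eps^-1)%:E)%E.
Proof.
apply: le_trans (smallest_part_pot_le_term q 0) _; rewrite lee_fin.
by case: ifP => _ //; rewrite gerBl trunc_inv_ge0.
Qed.

Lemma smallest_part_pot_le q k : fin_parts q -> 0 < q k ->
  (smallest_part_pot q <= (eps^-1 - trunc_inv (q k))%:E)%E.
Proof.
move=> fq qk; have [N [kN qN qN1]] := last_part fq qk.
apply: le_trans (smallest_part_pot_le_term q N) _; rewrite qN qN1 eqxx/= lee_fin.
have [_ dq _] := fq.
by rewrite lerD2l lerN2; apply: trunc_inv_noninc; [exact: ltW|exact: dq].
Qed.

Lemma smallest_part_potE p N : nneg_seq p -> noninc_seq p -> 0 < p N -> p N.+1 = 0 ->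
  smallest_part_pot p = (eps^-1 - trunc_inv (p N))%:E.
Proof.
move=> p0 dp pN pN1; apply/eqP; rewrite eq_le; apply/andP; split.
  by apply: le_trans (smallest_part_pot_le_term p N) _; rewrite pN pN1 eqxx.
apply: le_ereal_inf_tmp => _ [k _ <-]; rewrite lee_fin.
case: ifPn => [/andP[pk /eqP pk1]|_]; last by rewrite gerBl trunc_inv_ge0.
suff -> : k = N by [].
apply/eqP; rewrite eqn_leq; apply/andP; split; rewrite leqNgt; apply/negP => h.
  by move: pk; rewrite (fin_parts_tail p0 dp pN1 h) ltxx.
by move: pN; rewrite (fin_parts_tail p0 dp pk1 h) ltxx.
Qed.

Lemma smallest_part_pot_infinite p : (forall k, p k.+1 != 0) ->
  smallest_part_pot p = (eps^-1)%:E.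
Proof.
move=> pn; apply/eqP; rewrite eq_le smallest_part_pot_le_max/=.
by apply: le_ereal_inf_tmp => _ [k _ <-]; rewrite (negbTE (pn k)) andbF.
Qed.

Lemma measurable_smallest_part_pot :
  measurable_fun setT (fun p : borel (Omega1_type R) => smallest_part_pot (val1 p)).
Proof.
apply: (measurable_fun_einfs (f := fun k (p : borel (Omega1_type R)) =>
  (if (0 < val1 p k) && (val1 p k.+1 == 0)
   then eps^-1 - trunc_inv (val1 p k) else eps^-1)%:E)) => k.
apply/measurable_EFinP; apply: measurable_fun_ifT => //.
  apply: measurable_and.
    by apply: measurable_fun_ltr => //; exact: measurable_part.
  by apply: measurable_fun_eqr => //; exact: measurable_part.
apply: measurable_funB => //; apply: measurableT_comp; last exact: measurable_part.
by apply: continuous_measurable_fun; exact: trunc_inv_continuous.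
Qed.

End smallest_part.

(** * Infinite inverse moment *)

Section infinite_inverse_moment.
Context (R : realType) (sigma : probability R R).
Hypothesis hsigma : sigma (half_interval R) = 1%E.
Variables (bm bs : R).
Hypothesis hbm : 0 < bm <= 1.
Hypothesis hbs : 0 < bs <= 1.
Implicit Types (p q : seqs R).

Import HBNNSimple.

(** A simple function below 1/u is bounded by some b, and a function bounded by
    both b and 1/u is at most 2 / (u + 1/b). *)
Lemma trunc_inv_moment_unbounded :
  (\int[sigma]_(x in half_interval R) (x^-1)%:E = +oo)%E ->
  forall M : R, exists2 eps : R, 0 < eps &
    (M%:E <= \int[sigma]_(u in half_interval R) (trunc_inv eps u)%:E)%E.
Proof.
move=> Ioo M.
have inv0 u : half_interval R u -> (0 <= (u^-1)%:E)%E.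
  by rewrite /half_interval/= in_itv/= => /andP[u0 _]; rewrite lee_fin invr_ge0 ltW.
move: Ioo; rewrite ge0_integralE// => Ioo.
have : ((2 * M)%:E < +oo :> \bar R)%E by rewrite ltry.
rewrite -Ioo => /ereal_sup_gt[_ [h /= hu <-] Mh].
have [b b0 hb] : exists2 b : R, 0 < b & forall x, h x <= b.
  have [b [_ hb]] := simple_bounded h.
  exists (`|b| + 1); first by rewrite ltr_wpDl.
  move=> x; apply: le_trans (ler_norm _) _; apply: (hb (`|b| + 1)) => //.
  by rewrite (le_lt_trans (ler_norm b))// ltrDl.
exists b^-1; first by rewrite invr_gt0.
have h2 : (sintegral sigma h <=
    2%:E * \int[sigma]_(u in half_interval R) (trunc_inv b^-1 u)%:E)%E.
  apply: (@le_trans _ _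
    (\int[sigma]_(u in half_interval R) (2 * trunc_inv b^-1 u)%:E)%E); last first.
    under eq_integral do rewrite EFinM.
    rewrite ge0_integralZl//; first exact: measurable_half.
      apply/measurable_EFinP; apply: measurable_funTS.
      by apply: continuous_measurable_fun; apply: trunc_inv_continuous; rewrite invr_gt0.
    by move=> u _; rewrite lee_fin trunc_inv_ge0// invr_gt0.
  rewrite ge0_integralE => [|u _]; last first.
    by rewrite lee_fin mulr_ge0// trunc_inv_ge0// invr_gt0.
  apply: ereal_sup_ubound; exists h => // u; have := hu u; rewrite !patchE.
  case: ifPn => // /set_mem; rewrite /half_interval/= in_itv/= => /andP[u0 _].
  rewrite !lee_fin => h1; have h3 := hb u.
  rewrite /trunc_inv gtr0_norm// ler_pdivlMr ?addr_gt0 ?invr_gt0// mulrDr.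
  have : h u * u <= u^-1 * u by rewrite ler_wpM2r// ltW.
  have : h u * b^-1 <= b * b^-1 by rewrite ler_wpM2r// invr_ge0 ltW.
  rewrite mulVf ?divff ?gt_eqF//; lra.
by move: (lt_le_trans Mh h2); rewrite EFinM lte_pmul2l// => /ltW.
Qed.

Section at_eps.
Variable eps : R.
Hypothesis eps0 : 0 < eps.
Notation pot := (smallest_part_pot eps).
Notation tinv := (trunc_inv eps).

(** A merge that leaves the last part p_N alone keeps it as an entry, so it
    cannot raise the potential; one that uses p_N raises it at most to 1/eps. *)
Lemma smallest_part_pot_mergep p N i j : fin_parts p -> 0 < p N -> p N.+1 = 0 ->
  (i < j)%N ->
  ((p i * p j)%:E * pot (mergep i j p) <=
   (p i * p j * (eps^-1 - tinv (p N)) +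
     (if j == N then p i * p j * tinv (p N) else 0))%:E)%E.
Proof.
move=> fp pN pN1 ij; have [p0 dp _] := fp.
have w0 : (0 <= (p i * p j)%:E)%E by rewrite lee_fin mulr_ge0.
case: ltngtP => [jN|Nj|->].
- rewrite addr0 [leRHS]EFinM; apply: lee_wpmul2l => //.
  have [k pk] := mergep_old ij jN dp.
  by rewrite -pk; apply: smallest_part_pot_le; rewrite ?pk//; exact: fin_parts_mergep.
- by rewrite (fin_parts_tail p0 dp pN1 Nj) !(mulr0, mul0r) mul0e addr0.
- rewrite -mulrDr subrK [leRHS]EFinM; apply: lee_wpmul2l.
    by rewrite lee_fin mulr_ge0.
  exact: smallest_part_pot_le_max.
Qed.

(** After any split there is an entry no larger than the former smallest part:
    either that part itself, or the fraction u <= 1/2 of it. *)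
Lemma smallest_part_pot_splitp p N i : fin_parts p -> 0 < p N -> p N.+1 = 0 ->
  ((p i ^+ 2)%:E * \int[sigma]_(u in half_interval R) pot (splitp i u p) <=
   (p i ^+ 2 * (eps^-1 - tinv (p N)))%:E)%E.
Proof.
move=> fp pN pN1; have [p0 dp _] := fp.
have [Ni|iN] := ltnP N i.
  by rewrite (fin_parts_tail p0 dp pN1 Ni) expr0n/= mul0e mul0r.
rewrite [leRHS]EFinM; apply: lee_wpmul2l; first by rewrite lee_fin sqr_ge0.
rewrite -(integral_half_cst hsigma); apply: le_lower_integral => [u _|u].
  exact: smallest_part_pot_ge0.
rewrite /half_interval/= in_itv/= => /andP[u0 u2].
have u01 : 0 <= u <= 1 by lra.
have fs := fin_parts_splitp i u01 fp.
have [k [sk0 skN]] : exists k, 0 < splitp i u p k /\ splitp i u p k <= p N.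
  move: iN; rewrite leq_eqVlt => /predU1P[->|iN].
    have [k kE] := splitp_new N u01 fp; exists k; rewrite kE mulr_gt0//; split=> //.
    by rewrite ler_piMl// ?ltW//; lra.
  by have [k kE] := splitp_old u iN dp; exists k; rewrite kE.
apply: (le_trans (smallest_part_pot_le eps0 fs sk0)).
by rewrite lee_fin lerD2l lerN2; apply: (trunc_inv_noninc eps0) => //; exact: ltW.
Qed.

(** Splitting the largest part creates the entry u p_0 <= u, so the mean
    potential after the split is at most 1/eps - J, against a current value
    of at least 1/eps - 1/d. *)
Lemma smallest_part_pot_split0 p (d J : R) N : Omega1 R p -> fin_parts p ->
  d <= p N -> 0 < p N -> 0 < d -> p N.+1 = 0 ->
  (\int[sigma]_(u in half_interval R) (tinv u)%:E = J%:E)%E ->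
  ((p 0%N ^+ 2)%:E * \int[sigma]_(u in half_interval R) pot (splitp 0 u p)
    + (p 0%N ^+ 2 * (J - d^-1))%:E <= (p 0%N ^+ 2 * (eps^-1 - tinv (p N)))%:E)%E.
Proof.
move=> Op fp dN pN d0 pN1 IJ; have [p0 dp _ p1] := Omega1_facts Op.
have p00 : 0 < p 0%N by apply: lt_le_trans pN _; exact: dp.
have mt : measurable_fun (half_interval R) (EFin \o tinv).
  apply/measurable_EFinP; apply: measurable_funTS.
  by apply: continuous_measurable_fun; exact: trunc_inv_continuous.
have IB : (\int[sigma]_(u in half_interval R) (eps^-1 - tinv u)%:E = (eps^-1 - J)%:E)%E.
  have : (\int[sigma]_(u in half_interval R)
      ((eps^-1 - tinv u)%:E + (tinv u)%:E) = (eps^-1)%:E)%E.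
    rewrite -(integral_half_cst hsigma); apply: eq_integral => u _.
    by rewrite -EFinD subrK.
  rewrite ge0_integralD//=; last 4 first.
  - exact: measurable_half.
  - by move=> u _; rewrite lee_fin subr_ge0 trunc_inv_le.
  - apply/measurable_EFinP; apply: measurable_funB => //.
    exact/measurable_EFinP.
  - by move=> u _; rewrite lee_fin trunc_inv_ge0.
  rewrite IJ => h; rewrite EFinB -h addeK//.
have I : (\int[sigma]_(u in half_interval R) pot (splitp 0 u p) <= (eps^-1 - J)%:E)%E.
  rewrite -IB; apply: le_lower_integral => [u _|u]; first exact: smallest_part_pot_ge0.
  rewrite /half_interval/= in_itv/= => /andP[u0 u2].
  have u01 : 0 <= u <= 1 by lra.
  have fs := fin_parts_splitp 0 u01 fp.
  have [k sk] := splitp_new 0 u01 fp.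
  have sk0 : 0 < splitp 0 u p k by rewrite sk mulr_gt0.
  apply: (le_trans (smallest_part_pot_le eps0 fs sk0)).
  rewrite lee_fin lerD2l lerN2; apply: (trunc_inv_noninc eps0); first exact: ltW.
  by rewrite sk ler_piMr// ltW.
apply: le_trans.
  by apply: leeD2r; apply: lee_wpmul2l I; rewrite lee_fin sqr_ge0.
rewrite -EFinM -EFinD lee_fin -mulrDr ler_wpM2l ?sqr_ge0//.
have h1 : tinv (p N) <= d^-1.
  apply: le_trans (trunc_inv_le_inv eps0 pN) _.
  by rewrite lef_pV2 ?posrE.
lra.
Qed.

Definition all_parts_ge (d : R) : set (borel (Omega1_type R)) :=
  finitely_many_parts R `&`
  \bigcap_k ([set p | val1 p k = 0] `|` [set p | d <= val1 p k]).

Lemma measurable_all_parts_ge d : measurable (all_parts_ge d).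
Proof.
apply: measurableI; first exact: measurable_finitely_many_parts.
apply: bigcapT_measurable => k; apply: measurableU.
  exact: measurable_part_eq0.
exact: measurable_part_ge.
Qed.

Variable mu : probability (borel (Omega1_type R)) R.
Hypothesis hmu : K_invariant sigma bm bs mu.

(** The cost 2 bm accounts for the merges with the smallest part m: their
    total rate 2 bm m (1 - m) times the largest possible rise 1/(m + eps) stays
    below 2 bm for every eps. *)
Lemma all_parts_ge_bound (d J : R) : 0 < d -> d^-1 <= J ->
  (\int[sigma]_(u in half_interval R) (tinv u)%:E = J%:E)%E ->
  ((bs * (d ^+ 2 * (J - d^-1)))%:E * mu (all_parts_ge d) <= (2 * bm)%:E)%E.
Proof.
move=> d0 dJ IJ.
have [/andP[bm0 _] /andP[bs0 _]] := (hbm, hbs).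
have Jd0 : 0 <= J - d^-1 by rewrite subr_ge0.
have last (p : Omega1_type R) : finitely_many_parts R p ->
    fin_parts (val1 p) /\ exists N, 0 < val1 p N /\ val1 p N.+1 = 0.
  move=> [n [_ pn]]; have Op := val1_Omega1 p; have [p0 dp _ _] := Omega1_facts Op.
  have fp : fin_parts (val1 p) by split=> //; exists n.
  by split=> //; have [N [_ pN pN1]] := last_part fp (Omega1_part0_gt0 Op); exists N.
have key (p : Omega1_type R) N (a' : nat -> R) al' :
    fin_parts (val1 p) -> 0 < val1 p N -> val1 p N.+1 = 0 ->
    (forall i, 0 <= a' i) ->
    (forall i, ((val1 p i ^+ 2)%:E *
       \int[sigma]_(u in half_interval R) pot (splitp i u (val1 p))
       + (a' i)%:E <= (val1 p i ^+ 2 * (eps^-1 - tinv (val1 p N)))%:E)%E) ->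
    (al'%:E <= \sum_(i <oo) (a' i)%:E)%E ->
    (Kfun sigma bm bs pot (val1 p) + (bs * al')%:E <= pot (val1 p) + (2 * bm)%:E)%E.
  move=> fp pN pN1 a0 hS hal.
  have Op := val1_Omega1 p; have [p0 dp _ _] := Omega1_facts Op.
  have pE := smallest_part_potE eps0 p0 dp pN pN1.
  have := @Kfun_drift R sigma bm bs hbm hbs pot (val1 p) (eps^-1 - tinv (val1 p N))
    (fun _ _ => 0)
    (fun i j => if j == N then val1 p i * val1 p j * tinv (val1 p N) else 0)
    a' (fun=> 0) 0 1 al' 0 Op (smallest_part_pot_ge0 eps0) pE.
  rewrite !mulr0 mulr1 addr0 add0r pE; apply => //.
  - by move=> i j; case: ifP => // _; rewrite !mulr_ge0// trunc_inv_ge0.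
  - move=> i j ij; rewrite adde0; exact: smallest_part_pot_mergep.
  - by move=> i; rewrite addr0; exact: hS.
  - by rewrite eseries0// => j _ _; rewrite big1.
  - have S0 : 0 <= \sum_(i < N) val1 p i * val1 p N * tinv (val1 p N).
      by apply: sumr_ge0 => i _; rewrite !mulr_ge0// trunc_inv_ge0.
    rewrite (_ : (\sum_(j <oo) _)%E =
      (\sum_(j <oo) (if j == N
         then \sum_(i < N) val1 p i * val1 p N * tinv (val1 p N)
         else 0)%:E)%E); last first.
      apply: eq_eseriesr => j _; congr EFin; case: eqP => [->//|_].
      by rewrite big1.
    rewrite eseries_single// lee_fin.
    under eq_bigr do rewrite -mulrA.
    rewrite -mulr_suml; apply: mulr_ile1.
    + by apply: sumr_ge0.
    + by rewrite mulr_ge0// trunc_inv_ge0.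
    + by rewrite -(big_mkord xpredT (fun i => val1 p i)) Omega1_sum_le1.
    + by apply: mul_trunc_inv_le1 => //; exact: ltW.
  - by rewrite eseries0.
apply: (drift_inequality hbm hbs hmu (f := pot) (B := eps^-1)).
- exact: smallest_part_pot_ge0.
- by move=> p; exact: smallest_part_pot_le_max.
- exact: measurable_smallest_part_pot.
- exact: measurable_all_parts_ge.
- by rewrite !mulr_ge0// ?sqr_ge0 ?ltW.
- by rewrite mulr_ge0// ltW.
- move=> p [fp ge]; have [fs [N [pN pN1]]] := last p fp.
  have Op := val1_Omega1 p; have [p0 dp _ _] := Omega1_facts Op.
  have dN : d <= val1 p N by case: (ge N Logic.I) => //= pN0; rewrite pN0 ltxx in pN.
  have dp0 : d <= val1 p 0%N by apply: le_trans dN _; exact: dp.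
  apply: (key p N (fun i => if i == 0%N then val1 p 0%N ^+ 2 * (J - d^-1) else 0)) => //.
  + by move=> i; case: ifP => // _; rewrite mulr_ge0 ?sqr_ge0.
  + move=> [|i] /=; first exact: smallest_part_pot_split0.
    by rewrite adde0; exact: smallest_part_pot_splitp.
  + rewrite eseries_single ?mulr_ge0 ?sqr_ge0// lee_fin ler_wpM2r//.
    by rewrite lerXn2r// nnegrE//; exact: ltW.
- move=> p _; have [fp|nfp] := pselect (finitely_many_parts R p).
    have [fs [N [pN pN1]]] := last p fp.
    have := key p N (fun=> 0) 0 fs pN pN1 (fun=> lexx 0).
    rewrite mulr0 adde0; apply; last by rewrite eseries0.
    by move=> i; rewrite adde0; exact: smallest_part_pot_splitp.
  have Op := val1_Omega1 p; have [p0 dp _ _] := Omega1_facts Op.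
  have pE : pot (val1 p) = (eps^-1)%:E.
    apply: smallest_part_pot_infinite => // k.
    by apply/eqP => pk; apply: nfp; exists k.+1.
  have := @Kfun_drift R sigma bm bs hbm hbs pot (val1 p) eps^-1
    (fun _ _ => 0) (fun _ _ => 0) (fun=> 0) (fun=> 0) 0 0 0 0
    Op (smallest_part_pot_ge0 eps0) pE.
  rewrite !mulr0 addr0 adde0 => h; apply: (@le_trans _ _ (pot (val1 p))); last first.
    by rewrite leeDl// lee_fin mulr_ge0// ltW.
  rewrite pE -[leRHS]adde0; apply: h => //.
  + move=> i j ij; rewrite adde0 addr0 [leRHS]EFinM; apply: lee_wpmul2l.
      by rewrite lee_fin mulr_ge0.
    exact: smallest_part_pot_le_max.
  + move=> i; rewrite adde0 addr0 [leRHS]EFinM; apply: lee_wpmul2l.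
      by rewrite lee_fin sqr_ge0.
    rewrite -(integral_half_cst hsigma); apply: le_lower_integral => u _.
      exact: smallest_part_pot_ge0.
    exact: smallest_part_pot_le_max.
  + by rewrite eseries0// => j _ _; rewrite big1.
  + by rewrite eseries0// => j _ _; rewrite big1.
  + by rewrite eseries0.
  + by rewrite eseries0.
Qed.

End at_eps.

Variable mu : probability (borel (Omega1_type R)) R.
Hypothesis hmu : K_invariant sigma bm bs mu.

Lemma mu_finitely_many_parts0 :
  (\int[sigma]_(x in half_interval R) (x^-1)%:E = +oo)%E ->
  mu (finitely_many_parts R) = 0%E.
Proof.
move=> Ioo; have [/andP[bm0 _] /andP[bs0 _]] := (hbm, hbs).
have null (d : R) : 0 < d -> mu (all_parts_ge d) = 0%E.
  move=> d0; apply/eqP; rewrite eq_le measure_ge0 andbT.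
  apply/lee_addgt0Pr => e e0; rewrite add0e.
  set c := 2 * bm / (bs * d ^+ 2).
  have c0 : 0 < c by rewrite divr_gt0 ?mulr_gt0 ?exprn_gt0.
  have [eps eps0] := trunc_inv_moment_unbounded Ioo (d^-1 + c / e).
  set I := integral _ _ _ => IM.
  have Ie : (I <= (eps^-1)%:E)%E.
    rewrite -(integral_half_cst hsigma); apply: le_lower_integral => u _.
      by rewrite lee_fin trunc_inv_ge0.
    by rewrite lee_fin trunc_inv_le.
  have I0 : (0 <= I)%E by apply: integral_ge0 => u _; rewrite lee_fin trunc_inv_ge0.
  have Ifin : I \is a fin_num by rewrite ge0_fin_numE// (le_lt_trans Ie)// ltry.
  have IE : I = (fine I)%:E by rewrite fineK.
  move: IM; rewrite IE lee_fin => JM.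
  have ce0 : 0 < c / e by rewrite divr_gt0.
  have dJ : d^-1 <= fine I by lra.
  have w0 : 0 < bs * d ^+ 2 by rewrite mulr_gt0 ?exprn_gt0.
  have b1 : 0 < bs * (d ^+ 2 * (fine I - d^-1)) by rewrite mulrA mulr_gt0//; lra.
  have := all_parts_ge_bound eps0 hmu d0 dJ IE.
  rewrite muleC -lee_pdivlMr// => /le_trans; apply.
  rewrite -EFinM lee_fin ler_pdivrMr//.
  have cE : c * (bs * d ^+ 2) = 2 * bm by rewrite divfK// gt_eqF.
  have : c * (bs * d ^+ 2) <= (fine I - d^-1) * e * (bs * d ^+ 2).
    by rewrite ler_wpM2r ?(ltW w0)// -ler_pdivrMr//; lra.
  rewrite cE; lra.
apply/eqP; rewrite eq_le measure_ge0 andbT.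
have : (mu (finitely_many_parts R) <= \sum_(k <oo) mu (all_parts_ge (k.+1%:R^-1)%R))%E.
  apply: measure_sigma_subadditive.
  - by move=> k; exact: measurable_all_parts_ge.
  - exact: measurable_finitely_many_parts.
  move=> p fp; have Op := val1_Omega1 p; have [p0 dp _ _] := Omega1_facts Op.
  have [n [_ pn]] := fp.
  have fs : fin_parts (val1 p) by split=> //; exists n.
  have [N [_ pN pN1]] := last_part fs (Omega1_part0_gt0 Op).
  have [m mp] := ltr_add_invr pN; rewrite add0r in mp.
  exists m => //; split=> // k _ /=.
  have [kN|Nk] := leqP k N; last by left; exact: (fin_parts_tail p0 dp pN1 Nk).
  by right; apply: le_trans (ltW mp) _; exact: dp.
by rewrite eseries0// => k _ _; apply: null; rewrite invr_gt0.
Qed.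

End infinite_inverse_moment.

(** * The dichotomy *)

Theorem theorem1 (R : realType) (sigma : probability R R)
    (hsigma : sigma (half_interval R) = 1%E)
    (bm bs : R) (hbm : 0 < bm <= 1) (hbs : 0 < bs <= 1)
    (mu : probability (borel (Omega1_type R)) R)
    (hmu : K_invariant sigma bm bs mu) :
  ((\int[sigma]_(x in half_interval R) (x^-1)%:E < +oo)%E ->
     mu (finitely_many_parts R) = 1%E) /\
  ((\int[sigma]_(x in half_interval R) (x^-1)%:E = +oo)%E ->
     mu (finitely_many_parts R) = 0%E).
Proof.
split=> h.
  exact: (mu_finitely_many_parts1 hsigma hbm hbs hmu h).
exact: (mu_finitely_many_parts0 hsigma hbm hbs hmu h).
Qed.
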